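(* Let $G$ be a finitely generated group acting from the right on a non-empty set $X$ with finitely many orbits, and let $\mu$ be a finitely supported, symmetric, non-degenerate probability measure on $G$. Suppose that there are constants $D$ and $\alpha<1$ such that the drift function of $\mu$ satisfies $L_\mu(n)\le D n^\alpha$ for all $n\ge1$, and that there are constants $C$ and $\delta>0$ with $\delta>\alpha$ such that, for every $\rho\in X$, the probability of return to $\rho$ of the $n$-step random walk induced on $X$ satisfies $\mu^{*n}(\mathrm{stab}_G(\rho))\le C n^{-\delta}$ for all $n\ge1$. Let $A$ be a non-trivial finitely generated group. Then the permutational wreath product $W=A\wr_X G$ admits a symmetric probability measure with finite first moment and non-trivial Poisson-Furstenberg boundary. In particular, the word growth of $W$ is exponential.
   Context: A probability measure $\mu$ on a group $G$ is symmetric if $\mu(g)=\mu(g^{-1})$ for all $g$, and non-degenerate if its support generates $G$. For a finitely generated group with word norm $\|\cdot\|_S$ of a finite generating set $S$, the first moment of $\mu$ is $L(\mu)=\sum_g\mu(g)\|g\|_S$ (its finiteness does not depend on $S$), and the drift function is $L_\mu(n)=L(\mu^{*n})$, where $\mu^{*n}$ is the $n$-fold convolution power. The random walk induced on $X$ starts at a basepoint and moves from $x$ to $xg$ with probability $\mu(g)$; $\mathrm{stab}_G(\rho)$ is the stabilizer of $\rho$. Permutational wreath product: $A\wr_X G=\left(\sum_X A\right)\rtimes G$, where $\sum_X A$ is the group of finitely supported functions $f\colon X\to A$ (with $f(x)=1$ for all but finitely many $x$), on which $G$ acts by $(g\cdot f)(x)=f(xg)$; elements are written $fg$, with $(f_1g_1)(f_2g_2)=f_1(g_1\cdot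 f_2)g_1g_2$. If $A,G$ are finitely generated and $X$ has finitely many $G$-orbits, then $A\wr_XG$ is finitely generated. Random walk $(W,\mu)$: starts at $1$ and moves from $x$ to $xg$ with probability $\mu(g)$. Its Poisson-Furstenberg boundary is the quotient of the space of infinite trajectories by the measurable hull of the relation $\boldsymbol x\sim\boldsymbol y$ iff there are $N\in\mathbb N$, $k\in\mathbb Z$ with $\boldsymbol x_n=\boldsymbol y_{n+k}$ for all $n\ge N$. Equivalently: $F\colon W\to\mathbb R$ is $\mu$-harmonic if $F(g)=\sum_{h\in W}F(gh)\mu(h)$ for all $g$; the boundary is non-trivial if and only if $W$ admits a bounded $\mu$-harmonic function that is non-constant on the group generated by the support of $\mu$. Exponential word growth: $\lim_n v(n)^{1/n}>1$ where $v(n)$ is the number of group elements of word norm at most $n$. *)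

(* Defs.v *)
From HB Require Import structures.
From mathcomp Require Import all_boot all_order all_algebra finmap.
From mathcomp Require Import all_classical all_reals all_analysis.

Set Implicit Arguments.
Unset Strict Implicit.
Unset Printing Implicit Defensive.
Import Order.TTheory GRing.Theory Num.Theory.
Import numFieldNormedType.Exports.
Local Open Scope classical_set_scope.
Local Open Scope ring_scope.

Section Groups.
Variable G : groupType.
Implicit Types (S H : set G) (g : G).

Definition is_subgroup H : Prop :=
  H 1%g /\ (forall g h, H g -> H h -> H (g * h^-1)%g).

Definition generated S : set G := smallest is_subgroup S.

Definition finite_generating_set S : Prop :=
  finite_set S /\ generated S = [set: G].

Definition finitely_generated : Prop := exists S, finite_generating_set S.

Definition spelled S g (n : nat) : Prop :=
  exists w : seq G, [/\ size w = n,
    forall s, s \in w -> S s \/ S (s^-1)%g & (\prod_(s <- w) s)%g = g].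

(* Only meaningful when S generates G: the value is 0 outside generated S. *)
Definition word_norm S g : nat :=
  xget 0%N [set n | spelled S g n /\ forall m, spelled S g m -> (n <= m)%N].

Definition word_growth S (n : nat) : nat :=
  #|` fset_set [set g | (word_norm S g <= n)%N] |.

End Groups.

Definition exponential_growth (R : realType) (G : groupType) : Prop :=
  finitely_generated G /\
  forall S : set G, finite_generating_set S ->
    exists l : R, 1 < l /\
      ((word_growth S n)%:R `^ (n%:R^-1) : R) @[n --> \oo] --> l.

(* A probability measure on the discrete set G is given by its values on
   points. *)
Section Measures.
Variables (R : realType) (G : groupType).
Implicit Types (mu nu : G -> R) (S : set G).

Definition is_prob mu : Prop :=
  (forall g, 0 <= mu g) /\ \esum_(g in [set: G]) (mu g)%:E = 1%E.

Definition supp mu : set G := [set g | mu g != 0].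

Definition symmetric_measure mu : Prop := forall g, mu g = mu (g^-1)%g.

Definition non_degenerate mu : Prop := generated (supp mu) = [set: G].

Definition convolution mu nu : G -> R :=
  fun g => fine (\esum_(h in [set: G]) (mu h * nu (h^-1 * g)%g)%:E).

Fixpoint conv_pow mu (n : nat) : G -> R :=
  if n is n'.+1 then convolution (conv_pow mu n') mu else fun g => (g == 1%g)%:R.

Definition first_moment S mu : \bar R :=
  \esum_(g in [set: G]) (mu g * (word_norm S g)%:R)%:E.

Definition finite_first_moment mu : Prop :=
  finitely_generated G /\
  forall S, finite_generating_set S -> (first_moment S mu < +oo)%E.

Definition drift S mu (n : nat) : \bar R := first_moment S (conv_pow mu n).

End Measures.

Section Boundary.
Variable W : groupType.

Definition trajectory : Type := nat -> W.
HB.instance Definition _ := Choice.on trajectory.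
HB.instance Definition _ := isPointed.Build trajectory (fun=> 1%g).

Definition cylinders : set (set trajectory) :=
  [set C | exists (n : nat) (w : W), C = [set x | x n = w]].

Definition path_space := g_sigma_algebraType cylinders.

(* The law of the random walk from 1, determined by its values on the
   trajectories with prescribed positions up to time n. *)
Definition walk_law (R : realType) (mu : W -> R)
    (P : probability path_space R) : Prop :=
  forall (n : nat) (w : nat -> W),
    P [set x : trajectory | forall i, (i <= n)%N -> x i = w i] =
    ((w 0%N == 1%g)%:R * \prod_(i < n) mu ((w i)^-1 * w i.+1)%g)%:E.

Definition traj_equiv (x y : trajectory) : Prop :=
  exists (N : nat) (k : int), forall n : nat, (N <= n)%N ->
    (0 <= n%:Z + k) /\ x n = y (absz (n%:Z + k)).

(* Measurable unions of equivalence classes: these are the measurable sets of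
   the quotient of the path space by the measurable hull of traj_equiv. *)
Definition boundary_events : set (set path_space) :=
  [set E : set path_space | measurable E /\ forall x y, traj_equiv x y -> E x -> E y].

Definition nontrivial_boundary (R : realType) (mu : W -> R) : Prop :=
  exists P : probability path_space R, walk_law mu P /\
    exists E, boundary_events E /\ (0 < P E < 1)%E.

End Boundary.

Record right_action (G : groupType) (X : Type) := RightAction {
  act :> X -> G -> X;
  act1 : forall x, act x 1%g = x;
  actM : forall x g h, act x (g * h)%g = act (act x g) h }.

Definition action_orbit (G : groupType) (X : Type) (a : right_action G X)
    (x : X) : set X := range (a x).

Definition finitely_many_orbits (G : groupType) (X : Type)
    (a : right_action G X) : Prop := finite_set (range (action_orbit a)).

Definition stab (G : groupType) (X : Type) (a : right_action G X) (x : X) :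
  set G := [set g | a x g = x].

(* Wreath f g stands for the element fg. *)
Record wreath (A G : groupType) (X : Type) (a : right_action G X) := Wreath {
  lamps : X -> A;
  base : G;
  finite_lamps : finite_set [set x | lamps x != 1%g] }.

Section WreathGroup.
Variables (A G : groupType) (X : Type) (a : right_action G X).
Local Notation W := (wreath A a).
Implicit Types u v w : W.

Lemma wreath_eq u v : lamps u =1 lamps v -> base u = base v -> u = v.
Proof.
case: u v => [f g p] [f' g' p'] /= /funext ff gg; subst f' g'.
by rewrite (Prop_irrelevance p p').
Qed.

Lemma finite_act_preimage (B : set X) (g : G) :
  finite_set B -> finite_set [set x | B (a x g)].
Proof.
move=> fB; apply: (@sub_finite_set _ _ ((fun x => a x g^-1%g) @` B)).
  by move=> x /= Bx; exists (a x g) => //; rewrite -actM mulgV act1.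
exact: finite_image.
Qed.

Lemma finite_lamps1 : finite_set [set x : X | (1 : A)%g != 1%g].
Proof. by apply: (sub_finite_set _ (@finite_set0 X)) => x /=; rewrite eqxx. Qed.

Lemma finite_lampsM u v :
  finite_set [set x | (lamps u x * lamps v (a x (base u)))%g != 1%g].
Proof.
have fv := finite_act_preimage (base u) (finite_lamps v).
have fuv : finite_set ([set x | lamps u x != 1%g] `|`
    [set x | lamps v (a x (base u)) != 1%g]).
  by rewrite finite_setU; split; [exact: finite_lamps | exact: fv].
apply: (sub_finite_set _ fuv) => x /=.
case: (eqVneq (lamps u x) 1%g) => [->|_ _]; last by left.
by rewrite mul1g; right.
Qed.

Lemma finite_lampsV u :
  finite_set [set x | ((lamps u (a x (base u)^-1))^-1)%g != 1%g].
Proof.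
apply: (sub_finite_set _ (finite_act_preimage (base u)^-1%g (finite_lamps u))).
by move=> x /=; apply: contra => /eqP ->; rewrite invg1.
Qed.

Definition wreath1 : W := Wreath a 1%g finite_lamps1.
Definition wreathM u v : W := Wreath a (base u * base v)%g (finite_lampsM u v).
Definition wreathV u : W := Wreath a (base u)^-1%g (finite_lampsV u).

Lemma wreathA : associative wreathM.
Proof. by move=> u v w; apply: wreath_eq => [x|] /=; rewrite ?actM mulgA. Qed.

Lemma wreath1M : left_id wreath1 wreathM.
Proof. by move=> u; apply: wreath_eq => [x|] /=; rewrite ?act1 mul1g. Qed.

Lemma wreathM1 : right_id wreath1 wreathM.
Proof. by move=> u; apply: wreath_eq => [x|] /=; rewrite mulg1. Qed.

Lemma wreathVM : left_inverse wreath1 wreathV wreathM.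
Proof. by move=> u; apply: wreath_eq => [x|] /=; rewrite mulVg. Qed.

Lemma wreathMV : right_inverse wreath1 wreathV wreathM.
Proof.
by move=> u; apply: wreath_eq => [x|] /=; rewrite -?actM mulgV ?act1 ?mulgV.
Qed.

HB.instance Definition _ := gen_eqMixin W.
HB.instance Definition _ := gen_choiceMixin W.
HB.instance Definition _ :=
  isGroup.Build W wreathA wreath1M wreathM1 wreathVM wreathMV.

End WreathGroup.

(* Main.v *)
Require Import Defs.
From HB Require Import structures.
From mathcomp Require Import all_boot all_order all_algebra finmap.
From mathcomp Require Import all_classical all_reals all_analysis.
From mathcomp Require Import zify ring lra.

Set Implicit Arguments.
Unset Strict Implicit.
Unset Printing Implicit Defensive.
Import Order.TTheory GRing.Theory Num.Theory.
Import numFieldNormedType.Exports.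
Local Open Scope classical_set_scope.
Local Open Scope ring_scope.

(** The group need not be analysed through entropy: one random walk on [G] gives
both the measure and the exponential growth.

Let [q] lie strictly between [2 ^ - delta] and the minimum of [1] and
[2 ^ - alpha], and consider the walk on [G] each of whose steps consists of
[2 ^ i] steps of law [mu], where [i] has probability [(1 - q) * q ^ i]. A step
has mean length at most the sum of [(1 - q) * q ^ i * D * 2 ^ (alpha * i)], which
is finite since [q * 2 ^ alpha < 1]. The induced walk on [X] is transient:
among [m] steps the largest index is less than [k] with probability
[(1 - q ^ k) ^ m], the sum of which over [m] is of order [q ^ - k], and a step of
index [k] brings the probability of a return down to [C * 2 ^ (- delta * k)];
the sum over [k] of [q ^ - k * 2 ^ (- delta * k)] is finite since
[q > 2 ^ - delta] ([green_bound]).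

For the boundary, use the part [i = 0] of the steps to switch the lamp at a
point [rho] by an element [b] of [A] or by its inverse ([walk_switch]). The value
of the lamp at [rho] changes only when the base fixes [rho], and this is expected
to happen finitely often. So some position of the walk is followed by less than
one expected further change ([green_small]); there the present value of the lamp
at [rho] is permanent with positive probability. The same holds after an
additional initial switch, which gives another permanent value. Hence the
eventual value of the lamp at [rho] separates two events of positive probability
([boundary_criterion]). The law of the walk on the space of trajectories is
obtained by expanding a uniform random point of the unit interval into
independent digits ([walk_law_exists]).

For the growth, make all jumps longer by a constant factor, so that the expected
number of returns to the starting point is at most [1 / 2], while the mean length
of a jump stays finite. Then some path of [4 * m] jumps has length [O(m)] and at
least [m] of its departures are never followed by a return ([cheap_path]).
Switching or not the lamp at each of these departures gives [2 ^ m] distinct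
elements of norm [O(m)] ([uniq_switch_choices]), and the limit in the definition
of exponential growth exists by subadditivity ([fekete]). *)

(** * Sums of nonnegative families *)

Section Sums.
Context {R : realType}.
Local Open Scope ereal_scope.

Lemma esum_ge_term (T : choiceType) (F : T -> \bar R) (t : T) :
  (forall i, 0 <= F i) -> F t <= \esum_(i in [set: T]) F i.
Proof.
move=> F0; apply: esum_ge; exists [set t]; last by rewrite fsbig_set1.
by split => //; exact: finite_set1.
Qed.

Lemma esumZl (T : choiceType) (x : \bar R) (F : T -> \bar R) :
  0 <= x -> (forall i, 0 <= F i) ->
  x * (\esum_(i in [set: T]) F i) = \esum_(i in [set: T]) (x * F i).
Proof.
case: x => [r||] //.
- rewrite lee_fin => r0 F0.
  rewrite /esum -ereal_supZl//; last first.
    apply/set0P; exists 0; exists set0; first by split.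
    by rewrite fsbig_set0.
  congr ereal_sup; apply/seteqP; split => y /=.
    move=> [_ [A sA <-] <-]; exists A => //.
    by rewrite ge0_mule_fsumr.
  move=> [A sA <-]; exists (\sum_(i \in A) F i); first by exists A.
  by rewrite ge0_mule_fsumr.
(* [x = +oo]: both sides are [+oo], unless every term vanishes. *)
- move=> _ F0; have [[i Fi]|Fi] := pselect (exists i, F i != 0).
    have Fi0 : 0 < F i by rewrite lt0e Fi F0.
    rewrite gt0_mulye; last exact: lt_le_trans Fi0 (esum_ge_term i F0).
    symmetry; apply/eqP; rewrite -leye_eq.
    apply: le_trans (esum_ge_term i _); last by move=> j; rewrite mule_ge0.
    by rewrite gt0_mulye.
  have F0' i : F i = 0 by apply: contrapT => /eqP ?; apply: Fi; exists i.
  rewrite !esum1 ?mule0// => i _; rewrite F0' ?mule0//.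
Qed.

(** Tonelli. *)
Lemma esum_exchange (T1 T2 : choiceType) (a : T1 -> T2 -> \bar R) :
  (forall i j, 0 <= a i j) ->
  \esum_(i in [set: T1]) \esum_(j in [set: T2]) a i j =
  \esum_(j in [set: T2]) \esum_(i in [set: T1]) a i j.
Proof.
move=> a0; rewrite !esum_esum//.
rewrite (@reindex_esum _ _ _ ([set: T2] `*`` fun=> [set: T1])
  ([set: T1] `*`` fun=> [set: T2]) (fun p => (p.2, p.1)))//.
split => //; first by move=> [? ?] [? ?] _ _ [-> ->].
by move=> [x y] _; exists (y, x).
Qed.

Lemma esum_single (T : choiceType) (t : T) (F : T -> \bar R) :
  (forall i, 0 <= F i) -> (forall i, i != t -> F i = 0) ->
  \esum_(i in [set: T]) F i = F t.
Proof.
move=> F0 Ft; rewrite -[RHS]esum_set1// [RHS]esum_mkcond.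
apply: eq_esum => i _; case: ifPn => //; rewrite notin_setE => /= /eqP.
exact: Ft.
Qed.

Lemma reindex_esumT (T T' : choiceType) (e : T -> T') (F : T' -> \bar R) :
  bijective e ->
  \esum_(j in [set: T']) F j = \esum_(i in [set: T]) F (e i).
Proof.
move=> be; apply: reindex_esum; split => //.
  by move=> x y _ _; exact: (bij_inj be).
by case: be => f ef fe y _; exists (f y).
Qed.

Lemma esum_inj (T T' : choiceType) (e : T -> T') (F : T' -> \bar R) :
  injective e -> (forall y, ~ range e y -> F y = 0) ->
  \esum_(j in [set: T']) F j = \esum_(i in [set: T]) F (e i).
Proof.
move=> ie F0; rewrite -(@reindex_esum _ _ _ [set: T] (range e))//; last first.
  split; [by move=> x _; exists x| by move=> x y _ _; exact: ie|].
  by move=> _ [x _ <-]; exists x.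
rewrite [RHS]esum_mkcond; apply: eq_esum => y _.
by case: ifPn => //; rewrite notin_setE; exact: F0.
Qed.

Definition mean (T : choiceType) (p : T -> R) (F : T -> \bar R) : \bar R :=
  \esum_(t in [set: T]) ((p t)%:E * F t).

Section Mean.
Variables (T : choiceType) (p : T -> R).
Hypothesis p0 : forall t, (0 <= p t)%R.
Implicit Types F : T -> \bar R.

Lemma mean_ge0 F : (forall t, 0 <= F t) -> 0 <= mean p F.
Proof. by move=> F0; apply: esum_ge0 => t _; rewrite mule_ge0 ?lee_fin. Qed.

Lemma le_mean F1 F2 : (forall t, F1 t <= F2 t) -> mean p F1 <= mean p F2.
Proof. by move=> F12; apply: le_esum => t _; rewrite lee_wpmul2l ?lee_fin. Qed.

Lemma eq_mean F1 F2 : F1 =1 F2 -> mean p F1 = mean p F2.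
Proof. by move=> /funext ->. Qed.

Lemma meanZ (x : \bar R) F : 0 <= x -> (forall t, 0 <= F t) ->
  mean p (fun t => x * F t) = x * mean p F.
Proof.
move=> x0 F0; rewrite /mean esumZl//; last first.
  by move=> t; rewrite mule_ge0 ?lee_fin.
by apply: eq_esum => t _; rewrite muleCA.
Qed.

Lemma meanD F1 F2 : (forall t, 0 <= F1 t) -> (forall t, 0 <= F2 t) ->
  mean p (fun t => F1 t + F2 t) = mean p F1 + mean p F2.
Proof.
move=> F10 F20; rewrite /mean -esumD; [|by move=> t _; rewrite mule_ge0 ?lee_fin..].
by apply: eq_esum => t _; rewrite ge0_muleDr.
Qed.

Lemma mean_esum (I : choiceType) (F : I -> T -> \bar R) :
  (forall i t, 0 <= F i t) ->
  mean p (fun t => \esum_(i in [set: I]) F i t) =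
  \esum_(i in [set: I]) mean p (F i).
Proof.
move=> F0; rewrite /mean [RHS]esum_exchange; last first.
  by move=> i t; rewrite mule_ge0 ?lee_fin.
by apply: eq_esum => t _; rewrite esumZl ?lee_fin.
Qed.

Hypothesis p1 : \esum_(t in [set: T]) (p t)%:E = 1.

Lemma mean_cst (x : \bar R) : 0 <= x -> mean p (fun=> x) = x.
Proof.
move=> x0; rewrite -[RHS]mule1 -p1 esumZl//.
by apply: eq_esum => t _; rewrite muleC.
Qed.

Lemma weight_le1 t : (p t <= 1)%R.
Proof. by rewrite -lee_fin -p1; apply: (esum_ge_term t) => s; rewrite lee_fin. Qed.

Lemma mean_lt_exists F (c : \bar R) : 0 <= c -> mean p F < c ->
  exists2 t, (0 < p t)%R & F t < c.
Proof.
move=> c0 Fc; apply: contrapT => no.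
suff : c <= mean p F by move=> /(lt_le_trans Fc); rewrite ltxx.
rewrite -[leLHS]mean_cst//; apply: le_esum => t _.
have := p0 t; rewrite le_eqVlt => /predU1P[<-|pt]; first by rewrite !mul0e.
apply: lee_wpmul2l; first by rewrite lee_fin ltW.
rewrite leNgt; apply/negP => le.
by apply: no; exists t.
Qed.

End Mean.
End Sums.

(** * Word norms and word growth *)

Section WordNorm.
Variables (G : groupType) (S : set G).
Implicit Types g h : G.

Lemma spelled1 : spelled S 1%g 0.
Proof. by exists [::]; rewrite big_nil; split. Qed.

Lemma spelled_letter s : S s -> spelled S s 1.
Proof.
move=> Ss; exists [:: s]; rewrite big_seq1; split => // t.
by rewrite inE => /eqP ->; left.
Qed.

Lemma spelledM g h m n :
  spelled S g m -> spelled S h n -> spelled S (g * h)%g (m + n).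
Proof.
move=> [u [<- Su <-]] [v [<- Sv <-]]; exists (u ++ v).
rewrite size_cat big_cat; split => // s; rewrite mem_cat => /orP[/Su|/Sv]//.
Qed.

Lemma spelledV g n : spelled S g n -> spelled S (g^-1)%g n.
Proof.
move=> [u [<- Su <-]]; elim: u Su => [|s u IHu] Su /=.
  by rewrite big_nil invg1; exact: spelled1.
rewrite big_cons invgM -addn1; apply: spelledM.
  by apply: IHu => t ut; apply: Su; rewrite inE ut orbT.
exists [:: s^-1%g]; rewrite big_seq1; split => // t.
rewrite inE => /eqP ->; rewrite invgK.
by case: (Su s (mem_head _ _)); [right|left].
Qed.

Lemma spelled_split g m n : spelled S g (m + n) ->
  exists h k, [/\ spelled S h m, spelled S k n & g = (h * k)%g].
Proof.
move=> [u [su Su <-]].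
exists (\prod_(s <- take m u) s)%g, (\prod_(s <- drop m u) s)%g.
split; last by rewrite -big_cat cat_take_drop.
- exists (take m u); split => //; first by rewrite size_takel// su leq_addr.
  by move=> s /mem_take; exact: Su.
- exists (drop m u); split => //; first by rewrite size_drop su addKn.
  by move=> s /mem_drop; exact: Su.
Qed.

Hypothesis S_gen : generated S = [set: G].

Lemma spelled_ex g : exists n, spelled S g n.
Proof.
have : generated S g by rewrite S_gen.
apply: (@smallest_sub _ _ _ [set g | exists n, spelled S g n]) => [|s Ss].
  split; first by exists 0%N; exact: spelled1.
  by move=> x y [m Sx] [n /spelledV Sy]; exists (m + n)%N; exact: spelledM.
by exists 1%N; exact: spelled_letter.
Qed.

Lemma word_normP g : spelled S g (word_norm S g) /\
  forall m, spelled S g m -> (word_norm S g <= m)%N.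
Proof.
apply: (@xgetPex _ 0%N [set n | spelled S g n /\
  forall m, spelled S g m -> (n <= m)%N]).
have ex : exists n, `[< spelled S g n >].
  by have [n gn] := spelled_ex g; exists n; apply/asboolP.
exists (ex_minn ex); case: ex_minnP => n /asboolP gn nmin.
by split => // m gm; apply: nmin; apply/asboolP.
Qed.

Lemma word_norm_spelled g : spelled S g (word_norm S g).
Proof. by have [] := word_normP g. Qed.

Lemma word_norm_le g n : spelled S g n -> (word_norm S g <= n)%N.
Proof. by have [_] := word_normP g; exact. Qed.

Lemma word_normM g h : (word_norm S (g * h)%g <= word_norm S g + word_norm S h)%N.
Proof. by apply: word_norm_le; apply: spelledM; exact: word_norm_spelled. Qed.

Lemma word_norm1 : word_norm S 1%g = 0%N.
Proof. by apply/eqP; rewrite -leqn0; apply: word_norm_le; exact: spelled1. Qed.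

Lemma word_normV g : word_norm S (g^-1)%g = word_norm S g.
Proof.
have le x : (word_norm S (x^-1)%g <= word_norm S x)%N.
  by apply: word_norm_le; apply: spelledV; exact: word_norm_spelled.
by apply/eqP; rewrite eqn_leq le/= -{1}(invgK g) le.
Qed.

Hypothesis S_fin : finite_set S.

Lemma finite_spelled n : finite_set [set g | spelled S g n].
Proof.
elim: n => [|n IHn].
  apply: (sub_finite_set _ (finite_set1 (1%g : G))) => g /= [u [/size0nil -> _ <-]].
  by rewrite big_nil.
have fS : finite_set (S `|` [set s | S (s^-1)%g]).
  rewrite finite_setU; split => //.
  apply: (sub_finite_set _ (finite_image (fun s => (s^-1)%g) S_fin)) => s /= Ss.
  by exists (s^-1)%g => //; rewrite invgK.
apply: (sub_finite_set _ (finite_image2 (fun s g => (s * g)%g) fS IHn)).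
move=> g [[|s u] []] //= [su] Su <-; exists s.
  exact: (Su s (mem_head _ _)).
exists (\prod_(t <- u) t)%g; last by rewrite big_cons.
by exists u; split => // t ut; apply: Su; rewrite inE ut orbT.
Qed.

Definition ball n : set G := [set g | (word_norm S g <= n)%N].

Lemma finite_ball n : finite_set (ball n).
Proof.
apply: (@sub_finite_set _ _ (\bigcup_(k in `I_n.+1) [set g | spelled S g k])).
  by move=> g gn; exists (word_norm S g) => //; exact: word_norm_spelled.
by apply: bigcup_finite => // k _; exact: finite_spelled.
Qed.

Lemma countable_fg : countable [set: G].
Proof.
suff -> : [set: G] = \bigcup_n ball n.
  by apply: bigcup_countable => // n _; apply: finite_set_countable; exact: finite_ball.
by apply/seteqP; split => // g _; exists (word_norm S g) => //=; rewrite /ball/=.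
Qed.

Lemma mem_ball n g : (g \in fset_set (ball n)) = (word_norm S g <= n)%N.
Proof. by rewrite in_fset_set; [rewrite mem_setE|exact: finite_ball]. Qed.

Lemma word_growth_ge n (l : seq G) : uniq l ->
  (forall g, g \in l -> (word_norm S g <= n)%N) -> (size l <= word_growth S n)%N.
Proof.
by move=> ul ln; apply: uniq_leq_size => // g /ln; rewrite -mem_ball.
Qed.

Lemma word_growth_gt0 n : (0 < word_growth S n)%N.
Proof.
apply: (@word_growth_ge n [:: 1%g]) => // g.
by rewrite inE => /eqP ->; rewrite word_norm1.
Qed.

Lemma word_growth_mono m n : (m <= n)%N -> (word_growth S m <= word_growth S n)%N.
Proof.
move=> mn; apply: word_growth_ge; first exact: fset_uniq.
by move=> g; rewrite mem_ball => /leq_trans; exact.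
Qed.

Lemma word_growthM m n :
  (word_growth S (m + n) <= word_growth S m * word_growth S n)%N.
Proof.
rewrite /word_growth -(size_allpairs (fun x y : G => (x * y)%g) (fset_set (ball m))
  (fset_set (ball n))).
apply: uniq_leq_size; first exact: fset_uniq.
move=> g; rewrite mem_ball => gmn.
have [k [l [km ln wkl]]] : exists k l, [/\ (k <= m)%N, (l <= n)%N & word_norm S g = k + l]%N.
  exists (minn m (word_norm S g)), (word_norm S g - minn m (word_norm S g))%N.
  by split; lia.
have := word_norm_spelled g; rewrite wkl => /spelled_split[x [y [xk yl ->]]].
apply/allpairsP; exists (x, y); split => //=; rewrite mem_ball.
  exact: leq_trans (word_norm_le xk) km.
exact: leq_trans (word_norm_le yl) ln.
Qed.

End WordNorm.

(** A map that multiplies like a morphism can stretch word norms only by a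
bounded factor, the largest norm of the image of a generator. *)
Lemma word_norm_lipschitz (G H : groupType) (S : set G) (T : set H) (f : G -> H) :
  finite_generating_set S -> finite_generating_set T ->
  (forall g h, f (g * h)%g = (f g * f h)%g) ->
  exists M : nat, forall g, (word_norm T (f g) <= M * word_norm S g)%N.
Proof.
move=> [fS gS] [fT gT] fM.
have f1 : f 1%g = 1%g by apply: (mulgI (f 1%g)); rewrite -fM !mulg1.
have fV g : f (g^-1)%g = ((f g)^-1)%g.
  by apply: (mulgI (f g)); rewrite -fM !mulgV.
exists (\max_(s <- fset_set S) word_norm T (f s))%N => g.
have [u [<- Su <-]] := word_norm_spelled gS g.
elim: u Su => [|s u IHu] Su; first by rewrite big_nil f1 word_norm1.
rewrite big_cons fM /= mulnS; apply: leq_trans (word_normM gT _ _) _.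
apply: leq_add; last by apply: IHu => t ut; apply: Su; rewrite inE ut orbT.
have [Ss|Ss] := Su s (mem_head _ _).
  by apply: (@leq_bigmax_seq _ _ xpredT (fun s => word_norm T (f s))) => //; rewrite in_fset_set// inE.
rewrite -(word_normV gT) -fV.
by apply: (@leq_bigmax_seq _ _ xpredT (fun s => word_norm T (f s))) => //; rewrite in_fset_set// inE.
Qed.

(** Fekete: the limit of [a n / n] is its infimum, because
[a n <= n / m * a m + (a m + a 0)] for every [m > 0]. *)
Lemma fekete (R : realType) (a : nat -> R) :
  (forall n, 0 <= a n) -> (forall m n, (m <= n)%N -> a m <= a n) ->
  (forall m n, a (m + n)%N <= a m + a n) ->
  exists l : R, (a n / n%:R @[n --> \oo] --> l) /\
    (forall c, (forall n, (0 < n)%N -> c <= a n / n%:R) -> c <= l).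
Proof.
move=> a0 amono aD.
have amul m q : a (q * m)%N <= q%:R * a m + a 0%N.
  elim: q => [|q IHq]; first by rewrite mul0n mul0r add0r.
  rewrite mulSn (le_trans (aD _ _))//; apply: le_trans (lerD (lexx _) IHq) _.
  by rewrite -natr1 mulrDl mul1r addrA [a m + _]addrC.
pose E := [set a n / n%:R | n in [set n | (0 < n)%N]].
have E0 : E !=set0 by exists (a 1%N / 1%:R); exists 1%N.
have Elb : lbound E 0 by move=> _ [n _ <-]; rewrite divr_ge0.
have hE : has_inf E by split => //; exists 0.
exists (inf E); split; last first.
  by move=> c cE; apply: lb_le_inf => // _ [n /= n0 <-]; exact: cE.
apply/cvgrPdist_le => /= e e0.
have [_ [m /= m0 <-] am] := inf_adherent (divr_gt0 e0 (ltr0Sn R 1)) hE.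
have mR : 0 < m%:R :> R by rewrite ltr0n.
near=> n.
have n0 : (0 < n)%N by near: n; exact: nbhs_infty_gt.
have nR : 0 < n%:R :> R by rewrite ltr0n.
have infn : inf E <= a n / n%:R by apply: ge_inf; [exists 0|exists n].
rewrite distrC ger0_norm ?subr_ge0// lerBlDl.
have an : a n <= (n%:R / m%:R) * a m + (a m + a 0%N).
  have h1 := aD (n %/ m * m)%N (n %% m)%N.
  have h2 : a (n %% m)%N <= a m by apply: amono; rewrite ltnW// ltn_mod.
  have h3 : (n %/ m)%:R * a m <= n%:R / m%:R * a m.
    by rewrite ler_wpM2r// ler_pdivlMr// -natrM ler_nat leq_divM.
  by move: h1 (amul m (n %/ m)%N); rewrite -divn_eq; lra.
have : (a m + a 0%N) / n%:R <= e / 2.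
  rewrite ler_pdivrMr// -ler_pdivrMl ?divr_gt0//.
  by near: n; exact: nbhs_infty_ger.
have : a n / n%:R <= a m / m%:R + (a m + a 0%N) / n%:R.
  rewrite ler_pdivrMr// mulrDl divfK ?gt_eqF//.
  by apply: le_trans an _; rewrite lerD2r mulrC mulrA mulrAC.
lra.
Unshelve. all: by end_near. Qed.

(** Submultiplicativity turns [word_growth S (c * n) >= 2 ^ n] into
[word_growth S n >= 2 ^ (n / c)], so the limit that exists by [fekete] is at
least [2 ^ (1 / c)]. *)
Lemma exponential_growth_crit (R : realType) (G : groupType) :
  finitely_generated G ->
  (forall S : set G, finite_generating_set S -> exists c : nat,
     forall m, exists l : seq G, [/\ uniq l, (2 ^ m <= size l)%N &
       forall g, g \in l -> (word_norm S g <= c * m)%N]) ->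
  exponential_growth R G.
Proof.
move=> fgG H; split => // S [fS gS].
have [c cP] := H S (conj fS gS).
have v0 n : 0 < (word_growth S n)%:R :> R by rewrite ltr0n word_growth_gt0.
have v1 n : 1 <= (word_growth S n)%:R :> R by rewrite ler1n word_growth_gt0.
pose a n : R := ln (word_growth S n)%:R.
have a0 n : 0 <= a n by rewrite ln_ge0.
have amono m n : (m <= n)%N -> a m <= a n.
  by move=> mn; rewrite ler_ln ?posrE// ler_nat word_growth_mono.
have aD m n : a (m + n)%N <= a m + a n.
  by rewrite -lnM ?posrE// ler_ln ?posrE ?mulr_gt0// -natrM ler_nat word_growthM.
have ac n : n%:R * ln 2 <= a (c * n)%N.
  rewrite mulrC mulr_natr -lnXn// -natrX ler_ln ?posrE// ?ltr0n ?expn_gt0// ler_nat.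
  have [l [ul le lc]] := cP n.
  by apply: leq_trans le _; exact: word_growth_ge.
have ln2 : 0 < ln 2 :> R by rewrite ln_gt0// ltr1n.
have c0 : (0 < c)%N.
  rewrite lt0n; apply/eqP => c0.
  have [n] : exists n : nat, a 0%N / ln 2 < n%:R.
    by exists (Num.bound (a 0%N / ln 2)); rewrite archi_boundP// divr_ge0// ltW.
  by rewrite ltr_pdivrMr// ltNge => /negP; apply; have := ac n; rewrite c0 mul0n.
have cR : 0 < c%:R :> R by rewrite ltr0n.
have [l [al lP]] := fekete a0 amono aD.
have aM m n : a (m.+1 * n)%N <= m.+1%:R * a n.
  elim: m => [|m IHm]; first by rewrite mul1n mul1r.
  rewrite mulSn (le_trans (aD _ _))//; apply: le_trans (lerD (lexx _) IHm) _.
  by rewrite -[in leRHS]natr1 mulrDl mul1r addrC.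
exists (expR l); split.
  rewrite expR_gt1; apply: lt_le_trans (lP (ln 2 / c%:R) _).
    by rewrite divr_gt0.
  move=> n n0; rewrite ler_pdivlMr ?ltr0n// mulrAC ler_pdivrMr// mulrC.
  by rewrite [leRHS]mulrC (le_trans (ac n))// -(prednK c0) aM.
have -> : (fun n => (word_growth S n)%:R `^ n%:R^-1) = fun n => expR (a n / n%:R) :> R.
  by apply/funext => n; rewrite /powR gt_eqF// mulrC.
by apply: continuous_cvg al; exact: continuous_expR.
Qed.

(** * Visits of a chain with geometrically weighted jumps *)

Section GeometricMixture.
Context {R : realType}.
Variable q : R.
Hypotheses (q_gt0 : 0 < q) (q_lt1 : q < 1).

Definition geom_weight (i : nat) : R := (1 - q) * q ^+ i.

Lemma geom_weight_gt0 i : 0 < geom_weight i.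
Proof. by rewrite mulr_gt0 ?subr_gt0// exprn_gt0. Qed.

Lemma geom_weight_ge0 i : 0 <= geom_weight i.
Proof. by rewrite ltW// geom_weight_gt0. Qed.

Lemma esum_nat_le (f : nat -> \bar R) (x : \bar R) :
  (forall i, 0 <= f i)%E ->
  (forall n, \sum_(0 <= i < n) f i <= x)%E -> (\esum_(i in [set: nat]) f i <= x)%E.
Proof.
move=> f0 fx; rewrite -nneseries_esumT//; apply: lime_le.
  by apply: is_cvg_nneseries => n _ _; exact: f0.
by near=> n; exact: fx.
Unshelve. all: by end_near. Qed.

Lemma geom_sum (x : R) n : \sum_(0 <= i < n) x ^+ i * (1 - x) = 1 - x ^+ n.
Proof.
elim: n => [|n IHn]; first by rewrite big_geq// expr0 subrr.
by rewrite big_nat_recr//= IHn exprS; ring.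
Qed.

Lemma geom_weight_sum1 : (\esum_(i in [set: nat]) (geom_weight i)%:E = 1)%E.
Proof.
have w0 i : (0 <= (geom_weight i)%:E)%E by rewrite lee_fin geom_weight_ge0.
have sumE n : (\sum_(0 <= i < n) (geom_weight i)%:E)%E = (1 - q ^+ n)%:E.
  by rewrite sumEFin -geom_sum; congr (_%:E); apply: eq_bigr => i _; rewrite mulrC.
rewrite -nneseries_esumT//; apply/cvg_lim => //.
under eq_fun do rewrite sumE.
apply: cvg_EFin; first by near=> n.
rewrite (_ : fine \o _ = (fun n => 1 - q ^+ n))//.
rewrite -[X in _ --> X](subr0 1); apply: cvgB; first exact: cvg_cst.
by apply: cvg_expr; rewrite ger0_norm// ltW.
Unshelve. all: by end_near. Qed.

Let w0 := geom_weight_ge0.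
Let w1 := geom_weight_sum1.

Lemma geom_weight_lt k : mean geom_weight (fun i => (i < k)%:R%:E) = (1 - q ^+ k)%:E.
Proof.
elim: k => [|k IHk].
  by rewrite expr0 subrr; apply: esum1 => i _; rewrite mule0.
rewrite -[in RHS]geom_sum big_nat_recr//= geom_sum EFinD -IHk.
transitivity (mean geom_weight (fun i => (i < k)%:R%:E + (i == k)%:R%:E)%E).
  apply: eq_mean => i; rewrite -EFinD -natrD; congr (_%:R%:E).
  by rewrite ltnS leq_eqVlt; case: (ltngtP i k).
rewrite meanD//; [|by move=> i; rewrite lee_fin..]; congr (_ + _)%E.
rewrite /mean (esum_single (t := k)); first by rewrite eqxx mule1 mulrC.
  by move=> i; rewrite mule_ge0// lee_fin.
by move=> i /negbTE ->; rewrite mule0.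
Qed.

Lemma geom_weight_ge k : mean geom_weight (fun i => (k <= i)%:R%:E) = (q ^+ k)%:E.
Proof.
have : (mean geom_weight (fun i => (i < k)%:R%:E) +
  mean geom_weight (fun i => (k <= i)%:R%:E) = 1)%E.
  rewrite -meanD//; [|by move=> i; rewrite lee_fin..].
  rewrite -[RHS](mean_cst w0 w1 lee01); apply: eq_mean => i.
  by rewrite -EFinD -natrD; case: ltnP.
rewrite geom_weight_lt.
case: (mean _ _) => [r||] // /eqP; rewrite -EFinD eqe => /eqP r1.
by congr (_%:E); lra.
Qed.

Variable jump : nat -> nat.

(** The Markov operator of the chain on [nat] that jumps from [n] to
[n + jump i] with probability [geom_weight i]. *)
Definition jump_mean (v : nat -> \bar R) (n : nat) : \bar R :=
  mean geom_weight (fun i => v (n + jump i)%N).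

(** The same chain, killed by any jump of index at least [k]. *)
Definition jump_mean_lt k (v : nat -> \bar R) (n : nat) : \bar R :=
  mean geom_weight (fun i => ((i < k)%:R%:E * v (n + jump i)%N)%E).

Variables (u : nat -> \bar R) (b : nat -> R).
Hypotheses (u_ge0 : forall n, (0 <= u n)%E) (u_le1 : forall n, (u n <= 1)%E).
Hypotheses (b_ge0 : forall k, 0 <= b k).
Hypothesis u_le_b : forall k n, (jump k <= n)%N -> (u n <= (b k)%:E)%E.

(* the probability that the index of a jump is less than k *)
Local Notation s k := (1 - q ^+ k).

Lemma surviving_ge0 k : 0 <= s k.
Proof. by rewrite subr_ge0 exprn_ile1// ltW. Qed.

Lemma iter_jump_mean_ge0 m n : (0 <= iter m jump_mean u n)%E.
Proof. by elim: m n => //= m IHm n; apply: mean_ge0. Qed.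

Lemma iter_jump_mean_le1 m n : (iter m jump_mean u n <= 1)%E.
Proof.
elim: m n => //= m IHm n; rewrite -(mean_cst w0 w1 lee01); exact: le_mean.
Qed.

Lemma iter_jump_mean_lt_ge0 k m n : (0 <= iter m (jump_mean_lt k) u n)%E.
Proof.
elim: m n => //= m IHm n; apply: mean_ge0 => // i.
by rewrite mule_ge0// lee_fin.
Qed.

Lemma mean_geom_lt k (x : R) : 0 <= x ->
  mean geom_weight (fun i => ((i < k)%:R * x)%:E) = (s k * x)%:E.
Proof.
move=> x0; transitivity (mean geom_weight (fun i => x%:E * (i < k)%:R%:E)%E).
  by apply: eq_mean => i; rewrite -EFinM mulrC.
rewrite meanZ ?lee_fin//; [|by move=> i; rewrite lee_fin..].
by rewrite geom_weight_lt -EFinM mulrC.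
Qed.

Lemma iter_jump_mean_lt_le k l m n : (jump l <= n)%N ->
  (iter m (jump_mean_lt k) u n <= (s k ^+ m * b l)%:E)%E.
Proof.
elim: m n => [|m IHm] n ln; first by rewrite expr0 mul1r u_le_b.
rewrite iterS exprS -mulrA -mean_geom_lt; last by rewrite mulr_ge0// exprn_ge0// surviving_ge0.
apply: le_mean => // i; rewrite EFinM; apply: lee_wpmul2l; first by rewrite lee_fin.
by apply: IHm; rewrite (leq_trans ln)// leq_addr.
Qed.

(** The paths that survive killing at level [k.+1] but not at level [k] make a
jump of index [k], after which the value of [u] is at most [b k]. *)
Lemma iter_jump_mean_ltS k m n :
  (iter m (jump_mean_lt k.+1) u n <=
   iter m (jump_mean_lt k) u n + (s k.+1 ^+ m * b k)%:E)%E.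
Proof.
have pos m' : 0 <= s k.+1 ^+ m' * b k by rewrite mulr_ge0// exprn_ge0// surviving_ge0.
elim: m n => [|m IHm] n; first by rewrite /= leeDl// lee_fin.
rewrite !iterS exprS -mulrA -mean_geom_lt// /jump_mean_lt -meanD//; last 2 first.
- by move=> i; rewrite mule_ge0 ?lee_fin// iter_jump_mean_lt_ge0.
- by move=> i; rewrite lee_fin mulr_ge0.
apply: le_mean => // i; rewrite ltnS leq_eqVlt orbC.
case: ltnP => ik /=; first by rewrite mul1r !mul1e.
case: eqVneq => [->|_]; last by rewrite !mul0e mul0r adde0.
rewrite mul1e mul0e add0e mul1r; apply: iter_jump_mean_lt_le.
exact: leq_addl.
Qed.

Lemma iter_jump_mean_lt0 k m n :
  (iter m.+1 (jump_mean_lt k) u n <=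
   (\sum_(0 <= j < k) s j.+1 ^+ m.+1 * b j)%:E)%E.
Proof.
elim: k => [|k IHk].
  rewrite big_geq//= /jump_mean_lt /mean esum1// => i _.
  by rewrite ltn0 mul0e mule0.
rewrite big_nat_recr// EFinD; apply: le_trans (iter_jump_mean_ltS _ _ _) _.
by rewrite leeD2r.
Qed.

(** Replacing each of [m] jumps by death whenever its index is at least [k]
changes the outcome with probability at most [1 - (1 - q ^+ k) ^+ m]. *)
Lemma iter_jump_mean_le_lt k m n :
  (iter m jump_mean u n <= iter m (jump_mean_lt k) u n + (1 - s k ^+ m)%:E)%E.
Proof.
have sm0 m' : 0 <= 1 - s k ^+ m'.
  by rewrite subr_ge0 exprn_ile1 ?surviving_ge0// lerBlDr lerDl exprn_ge0// ltW.
elim: m n => [|m IHm] n; first by rewrite expr0 subrr adde0.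
rewrite !iterS.
have -> : 1 - s k ^+ m.+1 = s k * (1 - s k ^+ m) + q ^+ k by rewrite exprS; ring.
have ltE v n' : jump_mean_lt k v n' =
  mean geom_weight (fun i => ((i < k)%:R%:E * v (n' + jump i)%N)%E) by [].
rewrite EFinD -mean_geom_lt// -geom_weight_ge addeA ltE.
rewrite -!meanD//.
- apply: le_mean => // i; case: ltnP => ik.
    by rewrite mul1e mul1r adde0.
  by rewrite mul0e mul0r !add0e iter_jump_mean_le1.
- by move=> i; rewrite adde_ge0// ?mule_ge0// ?lee_fin ?mulr_ge0// iter_jump_mean_lt_ge0.
- by move=> i; rewrite mule_ge0 ?lee_fin// iter_jump_mean_lt_ge0.
- by move=> i; rewrite lee_fin mulr_ge0.
Qed.

Lemma one_minus_pow_le (x : R) m : 0 <= x <= 1 -> 1 - (1 - x) ^+ m <= m%:R * x.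
Proof.
move=> /andP[x0 x1]; elim: m => [|m IHm]; first by rewrite expr0 subrr mul0r.
have -> : 1 - (1 - x) ^+ m.+1 = x + (1 - x) * (1 - (1 - x) ^+ m) by rewrite exprS; ring.
have : (1 - x) * (1 - (1 - x) ^+ m) <= 1 - (1 - x) ^+ m.
  by rewrite ler_piMl ?subr_ge0 ?exprn_ile1//; lra.
rewrite -natr1; lra.
Qed.

(** Sort the paths of [m.+1] jumps by their largest index [j]. Such a path
contributes at most [b j], and the probability that no index exceeds [j] is
[(1 - q ^+ j.+1) ^+ m.+1], whose sum over [m] is at most [1 / q ^+ j.+1]. *)
Lemma green_bound (B : R) :
  (forall k, \sum_(0 <= j < k) b j / q ^+ j.+1 <= B) ->
  (\esum_(m in [set: nat]) iter m.+1 jump_mean u 0%N <= B%:E)%E.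
Proof.
move=> bB; apply: esum_nat_le => [m|M]; first exact: iter_jump_mean_ge0.
apply/lee_addgt0Pr => e e0.
(* Only finitely many numbers of jumps matter, and then only finitely many
   levels: killing above level k costs at most M * M * q ^+ k in total. *)
have [k kM] : exists k, (M * M)%:R * q ^+ k <= e.
  have : (M * M)%:R * q ^+ n @[n --> \oo] --> (0 : R).
    rewrite -[X in _ --> X](mulr0 (M * M)%:R); apply: cvgM; first exact: cvg_cst.
    by apply: cvg_expr; rewrite ger0_norm// ltW.
  move/cvgrPdist_le => /(_ e e0) [k _ /(_ k (leqnn k))] /=.
  by rewrite sub0r normrN => /(le_trans (ler_norm _)) ?; exists k.
have term m : (m < M)%N -> (iter m.+1 jump_mean u 0%N <=
    (\sum_(0 <= j < k) s j.+1 ^+ m.+1 * b j + M%:R * q ^+ k)%:E)%E.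
  move=> mM; apply: le_trans (iter_jump_mean_le_lt k _ _) _.
  rewrite [leRHS]EFinD; apply: leeD; first exact: iter_jump_mean_lt0.
  rewrite lee_fin; apply: le_trans (@one_minus_pow_le (q ^+ k) m.+1 _) _.
    by rewrite exprn_ge0 ?exprn_ile1// ltW.
  by rewrite ler_wpM2r ?ler_nat// exprn_ge0// ltW.
apply: (@le_trans _ _ (\sum_(0 <= m < M)
    (\sum_(0 <= j < k) s j.+1 ^+ m.+1 * b j + M%:R * q ^+ k)%:E)%E).
  rewrite !big_mkord; apply: lee_sum => m _; exact: term.
rewrite sumEFin -EFinD lee_fin big_split/=; apply: lerD; last first.
  by rewrite sumr_const_nat subn0 -[leLHS]mulr_natl mulrA -natrM.
apply: le_trans (bB k); rewrite exchange_big_nat/=.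
rewrite !big_mkord; apply: ler_sum => j _.
rewrite -mulr_suml mulrC ler_wpM2l// -div1r ler_pdivlMr ?exprn_gt0//.
rewrite mulr_suml; apply: (@le_trans _ _ (\sum_(0 <= m < M) s j.+1 ^+ m * (1 - s j.+1))).
  rewrite !big_mkord; apply: ler_sum => m _; rewrite subKr exprS.
  rewrite ler_wpM2r ?exprn_ge0 ?(ltW q_gt0)// ler_piMl ?exprn_ge0 ?surviving_ge0//.
  by rewrite lerBlDr lerDl exprn_ge0// ltW.
by rewrite geom_sum lerBlDr lerDl exprn_ge0// surviving_ge0.
Qed.

End GeometricMixture.

Lemma sum_geom_le (R : realType) (x c : R) n : 0 <= x < 1 -> 0 <= c ->
  \sum_(0 <= i < n) c * x ^+ i <= c / (1 - x).
Proof.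
move=> /andP[x0 x1] c0; have x1' : 0 < 1 - x by rewrite subr_gt0.
rewrite -mulr_sumr ler_wpM2l// -div1r ler_pdivlMr// mulr_suml geom_sum.
by rewrite lerBlDr lerDl exprn_ge0.
Qed.

Lemma esum_geom_lty (R : realType) (x c : R) : 0 <= x < 1 -> 0 <= c ->
  (\esum_(i in [set: nat]) (c * x ^+ i)%:E < +oo)%E.
Proof.
move=> /andP[x0 x1] c0; apply: le_lt_trans (ltry (c / (1 - x))).
apply: esum_nat_le => [i|n]; first by rewrite lee_fin mulr_ge0 ?exprn_ge0.
by rewrite sumEFin lee_fin sum_geom_le// x0.
Qed.

Lemma esum_nat_recl (R : realType) (f : nat -> \bar R) : (forall i, 0 <= f i)%E ->
  (\esum_(i in [set: nat]) f i <= f 0%N + \esum_(i in [set: nat]) f i.+1)%E.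
Proof.
move=> f0; have f0' : (0 <= \esum_(i in [set: nat]) f i.+1)%E by exact: esum_ge0.
apply: esum_nat_le => // -[|n]; first by rewrite big_geq// adde_ge0.
rewrite big_nat_recl//; apply: leeD2l.
by rewrite -nneseries_esumT//; apply: nneseries_lim_ge => i _ _.
Qed.

Lemma green_bound_geom (R : realType) (q t C : R) (jump : nat -> nat) (u : nat -> \bar R) :
  0 < q -> q < 1 -> 0 <= t -> t < q -> 0 <= C ->
  (forall n, 0 <= u n)%E -> (forall n, u n <= 1)%E ->
  (forall k n, (jump k <= n)%N -> (u n <= (C * t ^+ k)%:E)%E) ->
  (\esum_(m in [set: nat]) iter m.+1 (jump_mean q jump) u 0%N <= (C / (q - t))%:E)%E.
Proof.
move=> q0 q1 t0 tq C0 u0 u1 ut.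
have qt : 0 < q - t by rewrite subr_gt0.
apply: (green_bound q0 q1 u0 u1 _ ut) => [k|k].
  by rewrite mulr_ge0 ?exprn_ge0.
have -> : C / (q - t) = (C / q) / (1 - t / q) by field; lra.
rewrite (le_trans _ (@sum_geom_le _ (t / q) (C / q) k _ _))//.
- rewrite !big_mkord; apply: ler_sum => j _.
  by rewrite exprS invfM expr_div_n mulrACA.
- by rewrite divr_ge0 ?(ltW q0)//= ltr_pdivrMr// mul1r.
- by rewrite divr_ge0// ltW.
Qed.

(** * Random walks on groups *)

Section WalkOperators.
Context {R : realType}.
Local Open Scope ereal_scope.

Lemma mean_exchange (T1 T2 : choiceType) (p1 : T1 -> R) (p2 : T2 -> R)
    (F : T1 -> T2 -> \bar R) :
  (forall s, 0 <= p1 s)%R -> (forall t, 0 <= p2 t)%R -> (forall s t, 0 <= F s t) ->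
  mean p1 (fun s => mean p2 (F s)) = mean p2 (fun t => mean p1 (F^~ t)).
Proof.
move=> p10 p20 F0; rewrite mean_esum//; last first.
  by move=> t s; rewrite mule_ge0 ?lee_fin.
by apply: eq_esum => t _; rewrite meanZ// lee_fin.
Qed.

Lemma mean_single (T : choiceType) (p : T -> R) (t : T) :
  (forall s, 0 <= p s)%R -> mean p (fun s => (s == t)%:R%:E) = (p t)%:E.
Proof.
move=> p0; rewrite /mean (esum_single (t := t)) ?eqxx ?mule1//.
  by move=> s; rewrite mule_ge0 ?lee_fin.
by move=> s /negbTE ->; rewrite mule0.
Qed.

(** A mixture of probability measures; [fine] loses nothing because the sum is
at most [1]. *)
Definition mixture (I T : choiceType) (c : I -> R) (p : I -> T -> R) (t : T) : R :=
  fine (mean c (fun i => (p i t)%:E)).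

Section Mixture.
Variables (I T : choiceType) (c : I -> R) (p : I -> T -> R).
Hypotheses (c0 : forall i, (0 <= c i)%R) (c1 : \esum_(i in [set: I]) (c i)%:E = 1).
Hypotheses (p0 : forall i t, (0 <= p i t)%R)
  (p1 : forall i, \esum_(t in [set: T]) (p i t)%:E = 1).

Lemma mixtureE t : (mixture c p t)%:E = mean c (fun i => (p i t)%:E).
Proof.
rewrite fineK// ge0_fin_numE; last by apply: mean_ge0 => // i; rewrite lee_fin.
apply: le_lt_trans (ltry 1); rewrite -(mean_cst c0 c1 lee01).
by apply: le_mean => // i; rewrite lee_fin; exact: weight_le1.
Qed.

Lemma mixture_ge0 t : (0 <= mixture c p t)%R.
Proof.
by rewrite -lee_fin mixtureE; apply: mean_ge0 => // i; rewrite lee_fin.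
Qed.

Lemma mean_mixture F : (forall t, 0 <= F t) ->
  mean (mixture c p) F = mean c (fun i => mean (p i) F).
Proof.
move=> F0; rewrite mean_esum//; last first.
  by move=> t i; rewrite mule_ge0 ?lee_fin.
apply: eq_esum => t _; rewrite mixtureE muleC -meanZ//.
  by apply: eq_mean => i; rewrite muleC.
by move=> i; rewrite lee_fin.
Qed.

Lemma mixture_sum1 : \esum_(t in [set: T]) (mixture c p t)%:E = 1.
Proof.
transitivity (mean (mixture c p) (fun=> 1)).
  by apply: eq_esum => t _; rewrite mule1.
rewrite mean_mixture// -[RHS](mean_cst c0 c1 lee01).
by apply: eq_mean => i; rewrite mean_cst.
Qed.

End Mixture.

Section Groups.
Variable G : groupType.
Implicit Types p q mu : G -> R.

(** The Markov operator of the right random walk with step law [p]. *)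
Definition step_mean p (F : G -> \bar R) (g : G) : \bar R :=
  mean p (fun h => F (g * h)%g).

Lemma mul_bij (h : G) : bijective (fun g => (h * g)%g).
Proof. by exists (fun g => (h^-1 * g)%g) => g; rewrite ?mulKg ?mulVKg. Qed.

Lemma mean_translate p (h : G) (F : G -> \bar R) :
  mean (fun g => p (h^-1 * g)%g) F = step_mean p F h.
Proof.
rewrite /step_mean /mean [LHS](reindex_esumT _ (mul_bij h)).
by apply: eq_esum => g _; rewrite mulKg.
Qed.

Lemma convolutionE p q :
  convolution p q = mixture p (fun h g => q (h^-1 * g)%g).
Proof.
apply/funext => g; rewrite /convolution /mixture /mean.
by congr fine; apply: eq_esum => h _; rewrite EFinM.
Qed.

Lemma translate_sum1 p (h : G) : is_prob p ->
  \esum_(g in [set: G]) (p (h^-1 * g)%g)%:E = 1.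
Proof.
move=> [p0 p1]; rewrite (reindex_esumT _ (mul_bij h)) -[RHS]p1.
by apply: eq_esum => g _; rewrite mulKg.
Qed.

Lemma is_prob_convolution p q : is_prob p -> is_prob q -> is_prob (convolution p q).
Proof.
move=> Pp Pq; rewrite convolutionE; case: (Pp) (Pq) => [p0 p1] [q0 q1].
split; [move=> g; apply: mixture_ge0 => // h|apply: mixture_sum1 => // h];
  by exact: translate_sum1.
Qed.

Lemma mean_convolution p q F : is_prob p -> is_prob q -> (forall g, 0 <= F g) ->
  mean (convolution p q) F = mean p (step_mean q F).
Proof.
move=> Pp Pq F0; rewrite convolutionE; case: (Pp) (Pq) => [p0 p1] [q0 q1].
rewrite mean_mixture// => [|h]; last exact: translate_sum1.
by apply: eq_mean => h; rewrite mean_translate.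
Qed.

Variable mu : G -> R.
Hypothesis mu_prob : is_prob mu.

Lemma is_prob_conv_pow n : is_prob (conv_pow mu n).
Proof.
elim: n => [|n IHn] /=; last exact: is_prob_convolution.
split => [g|]; first by rewrite ler0n.
by rewrite (esum_single (t := 1%g)) ?eqxx//; move=> g /negbTE ->.
Qed.

Lemma conv_pow_ge0 n g : (0 <= conv_pow mu n g)%R.
Proof. by have [] := is_prob_conv_pow n. Qed.

Lemma step_mean_ge0 p F g : (forall h, 0 <= p h)%R -> (forall h, 0 <= F h) ->
  0 <= step_mean p F g.
Proof. by move=> p0 F0; exact: mean_ge0. Qed.

Lemma mean_conv_pow0 F : (forall g, 0 <= F g) -> mean (conv_pow mu 0) F = F 1%g.
Proof.
move=> F0; rewrite /mean (esum_single (t := 1%g)) /= ?eqxx ?mul1e//.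
  by move=> g; rewrite mule_ge0 ?lee_fin.
by move=> g /negbTE ->; rewrite mul0e.
Qed.

Lemma mean_conv_powD m n F : (forall g, 0 <= F g) ->
  mean (conv_pow mu (m + n)) F = mean (conv_pow mu m) (step_mean (conv_pow mu n) F).
Proof.
elim: n F => [|n IHn] F F0.
  rewrite addn0; apply: eq_mean => g.
  by rewrite /step_mean mean_conv_pow0// mulg1.
have [mu0 _] := mu_prob.
rewrite addnS [LHS]mean_convolution//; last exact: is_prob_conv_pow.
rewrite IHn; last by move=> g; exact: step_mean_ge0.
apply: eq_mean => g; rewrite [RHS]mean_convolution//; last exact: is_prob_conv_pow.
by apply: eq_mean => h; apply: eq_mean => k; rewrite mulgA.
Qed.

Lemma mean_conv_pow1 F : (forall g, 0 <= F g) -> mean (conv_pow mu 1) F = mean mu F.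
Proof.
move=> F0; have [mu0 _] := mu_prob.
rewrite [LHS]mean_convolution//; last exact: (is_prob_conv_pow 0).
rewrite mean_conv_pow0; last by move=> g; exact: step_mean_ge0.
by apply: eq_mean => g; rewrite mul1g.
Qed.

(** Inverting a product reverses its factors, and [mu] may be convolved with
[conv_pow mu n] on either side. *)
Lemma conv_pow_symmetric n : symmetric_measure mu -> symmetric_measure (conv_pow mu n).
Proof.
move=> mu_sym.
have [mu0 _] := mu_prob.
have inv_bij : bijective (fun g : G => g^-1)%g.
  by exists (fun g => g^-1)%g; exact: invgK.
have mean_inv F : (forall g, 0 <= F g) -> mean (conv_pow mu n) (fun g => F (g^-1)%g) =
    mean (conv_pow mu n) F.
  elim: n F => [|n IHn] F F0; first by rewrite !mean_conv_pow0// invg1.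
  rewrite [LHS]mean_convolution//; last exact: is_prob_conv_pow.
  rewrite mean_exchange//; last exact: conv_pow_ge0.
  rewrite -add1n mean_conv_powD// mean_conv_pow1; last first.
    by move=> g; apply: step_mean_ge0 => // h; exact: conv_pow_ge0.
  rewrite [RHS]/mean (reindex_esumT _ inv_bij); apply: eq_esum => h _.
  rewrite -mu_sym; congr (_ * _); rewrite /step_mean.
  rewrite -(IHn (fun k => F (h^-1 * k)%g))//.
  by apply: eq_mean => k; rewrite invgM.
move=> g; apply: EFin_inj.
rewrite -!mean_single; [|exact: conv_pow_ge0..].
rewrite -mean_inv => [|h]; last by rewrite lee_fin.
by apply: eq_mean => h; rewrite -eqg_inv invgK.
Qed.

Variables (q : R) (jump : nat -> nat).
Hypotheses (q_gt0 : (0 < q)%R) (q_lt1 : (q < 1)%R).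

(** The Markov operator of the walk whose step draws [i] with probability
[(1 - q) * q ^+ i] and then makes [jump i] steps of law [mu]. *)
Definition jump_step (F : G -> \bar R) (g : G) : \bar R :=
  mean (geom_weight q) (fun i => step_mean (conv_pow mu (jump i)) F g).

Lemma jump_step_ge0 F g : (forall h, 0 <= F h) -> 0 <= jump_step F g.
Proof.
move=> F0; apply: mean_ge0 => i; first exact: geom_weight_ge0.
by apply: step_mean_ge0 => // h; exact: conv_pow_ge0.
Qed.

Lemma iter_jump_step_ge0 m F g : (forall h, 0 <= F h) -> 0 <= iter m jump_step F g.
Proof. by move=> F0; elim: m g => //= m IHm g; exact: jump_step_ge0. Qed.

(** Along such a walk only the total number of steps of law [mu] matters. *)
Lemma mean_iter_jump_step m n F : (forall g, 0 <= F g) ->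
  mean (conv_pow mu n) (iter m jump_step F) =
  iter m (jump_mean q jump) (fun k => mean (conv_pow mu k) F) n.
Proof.
move=> F0; elim: m n => [//|m IHm] n /=; rewrite /jump_mean.
have F0' g : 0 <= iter m jump_step F g by exact: iter_jump_step_ge0.
rewrite mean_exchange; [|exact: conv_pow_ge0|by move=> i; exact: geom_weight_ge0|]; last first.
  by move=> g i; apply: step_mean_ge0 => // h; exact: conv_pow_ge0.
by apply: eq_mean => i; rewrite -IHm mean_conv_powD.
Qed.

Lemma iter_jump_stepE m F : (forall g, 0 <= F g) ->
  iter m jump_step F 1%g =
  iter m (jump_mean q jump) (fun k => mean (conv_pow mu k) F) 0%N.
Proof.
move=> F0; rewrite -mean_iter_jump_step// mean_conv_pow0// => g.
exact: iter_jump_step_ge0.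
Qed.

End Groups.
End WalkOperators.

(** * Random digits of a uniform point *)

Section DigitExpansion.
Context {R : realType}.
Variable p : nat -> R.
Hypotheses (p_ge0 : forall k, 0 <= p k)
  (p_sum1 : (\esum_(k in [set: nat]) (p k)%:E = 1)%E).

(** The unit interval is cut into consecutive slots, the [k]-th of length
[p k]; then each slot is stretched to the whole interval and cut again. *)
Definition cumul k : R := \sum_(0 <= i < k) p i.

Lemma cumulS k : cumul k.+1 = cumul k + p k.
Proof. by rewrite /cumul big_nat_recr. Qed.

Lemma cumul0 : cumul 0 = 0. Proof. by rewrite /cumul big_geq. Qed.

Lemma cumul_mono : {homo cumul : m n / (m <= n)%N >-> m <= n}.
Proof.
by apply: homo_leq => // [x y z|n]; [exact: le_trans|rewrite cumulS lerDl].
Qed.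

Lemma cumul_ge0 k : 0 <= cumul k. Proof. exact: sumr_ge0. Qed.

Lemma cumul_le1 k : cumul k <= 1.
Proof.
rewrite -lee_fin -p_sum1 -nneseries_esumT => [|i]; last by rewrite lee_fin.
rewrite -sumEFin; apply: nneseries_lim_ge => i _ _; by rewrite lee_fin.
Qed.

Definition in_slot (t : R) k : Prop := cumul k <= t < cumul k.+1.

Lemma in_slot_uniq t k l : in_slot t k -> in_slot t l -> k = l.
Proof.
move=> /andP[kt tk] /andP[lt tl]; apply/eqP; case: ltngtP => // kl.
  by have := lt_le_trans tk (le_trans (cumul_mono kl) lt); rewrite ltxx.
by have := lt_le_trans tl (le_trans (cumul_mono kl) kt); rewrite ltxx.
Qed.

Lemma in_slot_ex t : 0 <= t < 1 -> exists k, in_slot t k.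
Proof.
move=> /andP[t0 t1].
have ex : exists k, t < cumul k.
  apply: contrapT => no; have : (1 <= t%:E)%E; last by rewrite lee_fin leNgt t1.
  rewrite -p_sum1; apply: esum_nat_le => [i|n]; first by rewrite lee_fin.
  by rewrite sumEFin lee_fin leNgt; apply/negP => tn; apply: no; exists n.
case: (ex_minnP ex) => -[|k]; first by rewrite cumul0 ltNge t0.
move=> tk kmin; exists k; rewrite /in_slot tk andbT leNgt.
by apply/negP => /kmin; rewrite ltnn.
Qed.

Definition digit (t : R) : nat := xget 0%N [set k | in_slot t k].
Definition rest (t : R) : R := (t - cumul (digit t)) / p (digit t).

Lemma digitP t : 0 <= t < 1 -> in_slot t (digit t).
Proof.
by move=> /in_slot_ex; exact: (@xgetPex _ 0%N [set k | in_slot t k]).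
Qed.

Lemma digit_gt0 t : 0 <= t < 1 -> 0 < p (digit t).
Proof.
move=> /digitP /andP[le lt]; have := le_lt_trans le lt.
by rewrite cumulS ltrDl.
Qed.

Lemma rest_itv t : 0 <= t < 1 -> 0 <= rest t < 1.
Proof.
move=> t01; have p0 := digit_gt0 t01; have /andP[le lt] := digitP t01.
rewrite /rest divr_ge0 ?subr_ge0 ?(ltW p0)//= ltr_pdivrMr// mul1r.
by rewrite ltrBlDl -cumulS.
Qed.

Fixpoint digits (t : R) n : seq nat :=
  if n is n'.+1 then digit t :: digits (rest t) n' else [::].

Fixpoint cell_left (ks : seq nat) : R :=
  if ks is k :: ks' then cumul k + p k * cell_left ks' else 0.

Definition cell_length (ks : seq nat) : R := \prod_(k <- ks) p k.

Lemma cell_length_ge0 ks : 0 <= cell_length ks.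
Proof. exact: prodr_ge0. Qed.

Lemma cell_bounds ks : 0 <= cell_left ks /\ cell_left ks + cell_length ks <= 1.
Proof.
rewrite /cell_length; elim: ks => [|k ks [l0 l1]] /=.
  by rewrite big_nil add0r.
split; first by rewrite addr_ge0 ?cumul_ge0 ?mulr_ge0.
rewrite big_cons -addrA -mulrDr (le_trans _ (cumul_le1 k.+1))// cumulS lerD2l.
exact: ler_piMr.
Qed.

(** Cutting and stretching are affine on a slot, so the points with prescribed
first digits form an interval. A digit of weight [0] has an empty cell and is
never the digit of a point. *)
Lemma digits_cell t ks : 0 <= t < 1 ->
  digits t (size ks) = ks <-> cell_left ks <= t < cell_left ks + cell_length ks.
Proof.
rewrite /cell_length; elim: ks t => [|k ks IHks] t t01 /=.
  by rewrite big_nil add0r t01.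
have := cell_bounds ks; rewrite /cell_length => -[l0 l1].
have rt := rest_itv t01; rewrite big_cons -addrA -mulrDr; split.
  move=> [dk dks]; have p0 := digit_gt0 t01.
  have := (IHks _ rt).1 dks; rewrite /rest dk; rewrite dk in p0.
  by rewrite ler_pdivlMr// ltr_pdivrMr// lerBrDl ltrBlDl ![_ * p k]mulrC.
move=> /andP[le lt].
have p0 : 0 < p k.
  rewrite lt0r p_ge0 andbT; apply/eqP => p0.
  by have := le_lt_trans le lt; rewrite p0 !mul0r ltxx.
have tk : in_slot t k.
  rewrite /in_slot (le_trans _ le) ?lerDl ?mulr_ge0//=.
  by rewrite (lt_le_trans lt)// cumulS lerD2l ler_piMr.
have dk : digit t = k by exact: in_slot_uniq (digitP t01) tk.
congr cons => //; apply/(IHks _ rt); rewrite /rest dk.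
by rewrite ler_pdivlMr// ltr_pdivrMr// lerBrDl ltrBlDl ![_ * p k]mulrC le.
Qed.

Definition cell (ks : seq nat) : set R :=
  [set` `[cell_left ks, (cell_left ks + cell_length ks)[ ].

Lemma size_digits t n : size (digits t n) = n.
Proof. by elim: n t => //= n IHn t; rewrite IHn. Qed.

Lemma digits_cells n (Q : set (seq nat)) :
  `[0%R, 1%R[ `&` [set t | Q (digits t n)] =
  \bigcup_ks (if `[< size ks = n /\ Q ks >] then cell ks else set0).
Proof.
apply/seteqP; split => t.
  move=> [/= t01 Qt]; rewrite in_itv/= in t01; exists (digits t n) => //.
  case: asboolP => [_|[]]; last by rewrite size_digits.
  by rewrite /cell/= in_itv/=; apply/(digits_cell _ t01); rewrite size_digits.
move=> [ks _]; case: asboolP => // -[<- Qks]; rewrite /cell/= in_itv/= => tks.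
have [l0 l1] := cell_bounds ks.
have t01 : 0 <= t < 1.
  by case/andP: tks => le lt; rewrite (le_trans l0 le) (lt_le_trans lt l1).
by rewrite in_itv/=; split=> //; rewrite (digits_cell _ t01).2.
Qed.

(** Any condition on finitely many digits is a countable union of cells. *)
Lemma measurable_digits n (Q : set (seq nat)) :
  measurable (`[0%R, 1%R[ `&` [set t | Q (digits t n)] : set (measurableTypeR R)).
Proof.
rewrite digits_cells; apply: countable_bigcupT_measurable => // ks.
by case: asboolP => // _; exact: measurable_itv.
Qed.

End DigitExpansion.

Section UnitInterval.
Variable R : realType.

Definition unit_prob : set (measurableTypeR R) -> \bar R :=
  mrestr lebesgue_measure (measurable_itv `[0, 1[).

HB.instance Definition _ := Measure.on unit_prob.

Lemma unit_prob_setT : unit_prob [set: _] = 1%E.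
Proof.
by rewrite /unit_prob /mrestr setTI lebesgue_measure_itv/= lte_fin ltr01 oppr0 adde0.
Qed.

HB.instance Definition _ := Measure_isProbability.Build _ _ R unit_prob unit_prob_setT.

End UnitInterval.

(** * The random walk on the unit interval *)

Lemma countable_code (W : choiceType) : countable [set: W] ->
  exists (code : W -> nat) (decode : nat -> option W),
    pcancel code decode /\ forall k w, decode k = Some w -> code w = k.
Proof.
move=> /countable_injP[code code_inj].
pose decode k := if pselect (exists w, code w = k) is left e
  then Some (projT1 (cid e)) else None.
exists code, decode; split => [w|k w]; rewrite /decode; case: pselect => //.
- by move=> e; congr Some; apply: code_inj; rewrite ?inE//; case: cid.
- by case; exists w.
- by move=> e [<-]; case: cid.
Qed.

Section WalkLaw.
Variables (R : realType) (W : groupType) (nu : W -> R).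
Hypothesis nu_prob : is_prob nu.
Variables (code : W -> nat) (decode : nat -> option W).
Hypotheses (codeK : pcancel code decode)
  (decodeK : forall k w, decode k = Some w -> code w = k).

Definition code_weight k : R := oapp nu 0 (decode k).

Lemma code_weight_ge0 k : 0 <= code_weight k.
Proof. by rewrite /code_weight; case: (decode k) => //= w; case: nu_prob. Qed.

Lemma code_weight_sum1 : (\esum_(k in [set: nat]) (code_weight k)%:E = 1)%E.
Proof.
rewrite (esum_inj (pcan_inj codeK)) => [|k nk].
  by rewrite -[RHS]nu_prob.2; apply: eq_esum => w _; rewrite /code_weight codeK.
rewrite /code_weight; case dk: (decode k) => [w|] //=.
by case: nk; exists w => //; exact: decodeK.
Qed.

Definition place (ks : seq nat) : W := (\prod_(k <- ks) odflt 1 (decode k))%g.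

Local Notation digits := (digits code_weight).
Local Notation p0 := code_weight_ge0.
Local Notation p1 := code_weight_sum1.

(** A digit that occurs has positive weight, hence is the code of an element;
so positions determine digits. *)
Lemma place_digits n t (w : nat -> W) : 0 <= t < 1 -> w 0%N = 1%g ->
  (forall i, (i <= n)%N -> place (digits t i) = w i) <->
  digits t n = [seq code ((w i)^-1 * w i.+1)%g | i <- iota 0 n].
Proof.
elim: n t w => [|n IHn] t w t01 w0.
  by split=> // _ i; rewrite leqn0 => /eqP ->; rewrite /= /place big_nil.
have rt := rest_itv p0 p1 t01.
have [d dE] : exists d, decode (digit code_weight t) = Some d.
  have := digit_gt0 p0 p1 t01; rewrite {1}/code_weight.
  by case: decode => [d|]; [exists d|rewrite ltxx].
have placeS i : place (digits t i.+1) = (d * place (digits (rest code_weight t) i))%g.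
  by rewrite /place /= big_cons {1}dE.
have incrE i : ((d^-1 * w i.+1)^-1 * (d^-1 * w i.+2) = (w i.+1)^-1 * w i.+2)%g.
  by rewrite invgM invgK !mulgA mulgK.
rewrite /= -[1%N]addn0 iotaDl -map_comp.
under eq_map => i do rewrite /= add1n -incrE.
split.
  move=> H; have w1 : w 1%N = d by rewrite -(H 1%N)// placeS /place big_nil mulg1.
  rewrite w0 invg1 mul1g w1 (decodeK dE); congr cons.
  apply: (IHn _ (fun i => d^-1 * w i.+1)%g rt _).1; first by rewrite w1 mulVg.
  by move=> i ilen; rewrite -(H i.+1)// placeS mulKg.
move=> [dt dr]; have w1 : w 1%N = d.
  by move: dE; rewrite dt w0 invg1 mul1g codeK => -[].
move=> [_|i]; first by rewrite w0 /place /= big_nil.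
rewrite ltnS => ilen; rewrite placeS.
rewrite ((IHn _ (fun i => d^-1 * w i.+1)%g rt _).2 _ i ilen) ?mulVKg//.
by rewrite w1 mulVg.
Qed.

(** Points outside the unit interval have measure [0] for [unit_prob]; sending
them to [0] keeps the walk defined and measurable on the whole line. *)
Definition clip (t : R) : R := if 0 <= t < 1 then t else 0.

Definition unit_walk (t : measurableTypeR R) : path_space W :=
  fun n => place (digits (clip t) n).

Lemma unit_walk_itv t n : `[0, 1[%classic t -> unit_walk t n = place (digits t n).
Proof. by rewrite /= in_itv/= /unit_walk /clip => ->. Qed.

Lemma measurable_unit_walk : measurable_fun setT unit_walk.
Proof.
have M := @measurability _ _ (measurableTypeR R) (path_space W) setT unit_walk (@cylinders W).
apply: M => // _ [_ [n [w ->]] <-].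
rewrite setTI; pose Q : set (seq nat) := [set ks | place ks = w].
rewrite (_ : unit_walk @^-1` _ = (`[0, 1[ `&` [set t | Q (digits t n)]) `|`
    (~` `[0, 1[ `&` [set t | Q (digits 0 n)])).
  apply: measurableU; first exact: measurable_digits p0 p1 _ _.
  apply: measurableI; first by apply: measurableC; exact: measurable_itv.
  have [Q0|Q0] := pselect (Q (digits 0 n)).
    by rewrite (_ : [set _ | _] = setT)//; apply/seteqP; split.
  by rewrite (_ : [set _ | _] = set0)//; apply/seteqP; split.
apply/seteqP; split => t /=.
  move=> Xt; have [t01|t01] := pselect (`[0, 1[%classic t); [left|right].
    by split=> //; move: Xt; rewrite unit_walk_itv.
  by split => //; move: Xt; rewrite /Q/= /unit_walk /clip; case: ifPn.
move=> [[t01 Qt]|[t01 Qt]]; first by rewrite unit_walk_itv.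
by rewrite /unit_walk /clip; case: ifPn.
Qed.

Lemma unit_walk_law (w : nat -> W) n : w 0%N = 1%g ->
  unit_prob [set t : measurableTypeR R | forall i, (i <= n)%N -> unit_walk t i = w i] =
  (\prod_(i < n) nu ((w i)^-1 * w i.+1)%g)%:E.
Proof.
move=> w0; pose ks := [seq code ((w i)^-1 * w i.+1)%g | i <- iota 0 n].
rewrite /unit_prob /mrestr (_ : _ `&` _ = cell code_weight ks).
  rewrite /cell lebesgue_measure_itv/= lte_fin.
  have -> : \prod_(i < n) nu ((w i)^-1 * w i.+1)%g = cell_length code_weight ks.
    rewrite /cell_length /ks big_map.
    rewrite -(big_mkord xpredT (fun i => nu ((w i)^-1 * w i.+1)%g)) /index_iota subn0.
    by apply: eq_bigr => i _; rewrite /code_weight codeK.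
  rewrite ltrDl; case: ltP => [_|]; first by rewrite -EFinB addrAC subrr add0r.
  move=> le0; congr (_%:E); apply/eqP.
  by rewrite eq_le le0 cell_length_ge0//; exact: p0.
have sks : size ks = n by rewrite size_map size_iota.
have [l0 l1] := cell_bounds p0 p1 ks.
apply/seteqP; split => t; rewrite /cell/= !in_itv/=.
  move=> [tw t01]; apply/(digits_cell p0 p1 _ t01); rewrite sks.
  apply/(place_digits _ t01 w0) => i ilen; rewrite -tw//.
  by rewrite unit_walk_itv//= in_itv.
move=> tks; have t01 : 0 <= t < 1.
  by case/andP: tks => le lt; rewrite (le_trans l0 le) (lt_le_trans lt l1).
split => // i ilen; rewrite unit_walk_itv ?/= ?in_itv//.
have := (digits_cell p0 p1 ks t01).2 tks; rewrite sks.
by move=> /(place_digits _ t01 w0); exact.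
Qed.

(** The digits of a uniform point are independent with law [code_weight], so
their products perform the walk. *)
Lemma walk_law_exists : exists P : probability (path_space W) R, walk_law nu P.
Proof.
pose X : {mfun measurableTypeR R >-> path_space W} :=
  HB.pack unit_walk (isMeasurableFun.Build _ _ _ _ unit_walk measurable_unit_walk).
exists (distribution (unit_prob (R:=R)) X) => n w.
transitivity
  (unit_prob [set t : measurableTypeR R | forall i, (i <= n)%N -> unit_walk t i = w i]) => //.
have [w0|w0] := eqVneq (w 0%N) 1%g; first by rewrite mul1r unit_walk_law.
rewrite mul0r (_ : [set _ | _] = set0) ?measure0//.
apply/seteqP; split => // t /= tw; move: w0.
by rewrite -(tw 0%N)// /unit_walk /place big_nil eqxx.
Qed.

End WalkLaw.

(** * A criterion for a non-trivial boundary *)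

Section BoundaryCriterion.
Variables (R : realType) (W : groupType) (nu : W -> R).
Hypotheses (W_countable : countable [set: W]) (nu_prob : is_prob nu).
Variable P : probability (path_space W) R.
Hypothesis P_law : walk_law nu P.

Definition cylinder n (w : nat -> W) : set (path_space W) :=
  [set x : trajectory W | forall i, (i <= n)%N -> x i = w i].

Lemma measurable_coord n (B : set W) :
  measurable ([set x : trajectory W | B (x n)] : set (path_space W)).
Proof.
rewrite (_ : [set _ | _] = \bigcup_w
    (if `[< B w >] then [set x : trajectory W | x n = w] else set0)).
  apply: countable_bigcupT_measurable => // w; case: asboolP => // _.
  by apply: sub_sigma_algebra; exists n, w.
apply/seteqP; split => [x Bx|x [w _]]; last by case: asboolP => // Bw /= ->.
by exists (x n) => //; rewrite asboolT.
Qed.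

Lemma cylinderS n w :
  cylinder n.+1 w = cylinder n w `&` [set x : trajectory W | x n.+1 = w n.+1].
Proof.
apply/seteqP; split => x /=.
  by move=> xw; split; [move=> i /= ilen; apply: xw; exact: leqW|exact: xw].
by move=> [xw xn] i; rewrite leq_eqVlt ltnS => /predU1P[->//|]; exact: xw.
Qed.

Lemma measurable_cylinder n w : measurable (cylinder n w).
Proof.
elim: n => [|n IHn].
  rewrite (_ : cylinder 0 w = [set x : trajectory W | [set w 0%N] (x 0%N)]).
    exact: measurable_coord.
  apply/seteqP; split => x /= xw; first exact: xw.
  by move=> i; rewrite leqn0 => /eqP ->.
rewrite cylinderS; apply: measurableI => //.
exact: (measurable_coord _ [set w n.+1]).
Qed.

Definition extend n (w : nat -> W) (s : W) : nat -> W :=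
  fun i => if (i <= n)%N then w i else (w n * s)%g.

Lemma cylinder_extend n w s :
  P (cylinder n.+1 (extend n w s)) = (P (cylinder n w) * (nu s)%:E)%E.
Proof.
rewrite !P_law -EFinM big_ord_recr/= mulrA.
congr ((_ * _) * _)%:E; last by rewrite /extend leqnn ltnn mulKg.
by apply: eq_bigr => i _; rewrite /extend ltn_ord ltnW.
Qed.

(** Splitting according to the next step of the walk bounds the probability of
[A] after a prescribed beginning. *)
Lemma cylinder_split (A : set (path_space W)) n w (F : W -> \bar R) :
  measurable A -> (forall s, 0 <= F s)%E ->
  (forall s, P (cylinder n.+1 (extend n w s) `&` A) <=
     P (cylinder n w) * ((nu s)%:E * F s))%E ->
  (P (cylinder n w `&` A) <= P (cylinder n w) * mean nu F)%E.
Proof.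
move=> mA F0 PF; have [nu0 _] := nu_prob.
have [code [decode [codeK decodeK]]] := countable_code W_countable.
pose Ak k := if decode k is Some s then cylinder n.+1 (extend n w s) `&` A else set0.
have mAk k : measurable (Ak k).
  by rewrite /Ak; case: (decode k) => // s; apply: measurableI => //; exact: measurable_cylinder.
have mcA : measurable (cylinder n w `&` A).
  by apply: measurableI => //; exact: measurable_cylinder.
have sub : cylinder n w `&` A `<=` \bigcup_k Ak k.
  move=> x [xw Ax]; exists (code ((w n)^-1 * x n.+1)%g) => //.
  rewrite /Ak codeK; split => // i; rewrite leq_eqVlt ltnS /extend => /predU1P[->|ilen].
    by rewrite ltnn mulVKg.
  by rewrite ilen xw.
apply: le_trans (measure_sigma_subadditive P mAk mcA sub) _.
have nuF s : (0 <= (nu s)%:E * F s)%E by rewrite mule_ge0 ?lee_fin.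
rewrite nneseries_esumT// esumZl//.
apply: (@le_trans _ _ (\esum_(k in [set: nat])
    (if decode k is Some s then P (cylinder n w) * ((nu s)%:E * F s) else 0)%E)).
  by apply: le_esum => k _; rewrite /Ak; case: (decode k) => //; rewrite measure0.
rewrite (esum_inj (pcan_inj codeK)) => [|k nk].
  by apply: le_esum => s _; rewrite codeK.
by case dk: (decode k) => [s|] //; case: nk; exists s => //; exact: decodeK.
Qed.

Variables (T : Type) (obs : W -> T) (B : set W).
Hypothesis obs_const : forall w s, ~ B w -> nu s != 0 -> obs (w * s)%g = obs w.

Definition visits : W -> \bar R := fun w => (`[< B w >])%:R%:E.

Lemma visits_ge0 w : (0 <= visits w)%E. Proof. by rewrite lee_fin. Qed.

(** The Green function: the expected number of visits to [B] of the walk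
started at [w]. *)
Definition green (w : W) : \bar R :=
  (\esum_(m in [set: nat]) iter m (step_mean nu) visits w)%E.

Definition change n : set (path_space W) :=
  [set x : trajectory W | obs (x n) <> obs (x n.+1)].

Lemma measurable_change n : measurable (change n).
Proof.
rewrite (_ : change n = \bigcup_w ([set x : trajectory W | [set w] (x n)] `&`
    [set x : trajectory W | [set v | obs w <> obs v] (x n.+1)])).
  apply: countable_bigcupT_measurable => // w.
  by apply: measurableI; exact: measurable_coord.
by apply/seteqP; split => [x Bx|x [w _ [/= xn ?]]];
  [exists (x n)|rewrite /change /= xn].
Qed.

Lemma iter_visits_ge0 m w : (0 <= iter m (step_mean nu) visits w)%E.
Proof.
have [nu0 _] := nu_prob.
by elim: m w => [|m IHm] w; [exact: visits_ge0|exact: step_mean_ge0].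
Qed.

(** [obs] can change only at a visit to [B]. *)
Lemma change_le_visits m n w :
  (P (cylinder n w `&` change (n + m)) <=
   P (cylinder n w) * iter m (step_mean nu) visits (w n))%E.
Proof.
have [nu0 nu1] := nu_prob.
elim: m n w => [|m IHm] n w; last first.
  apply: cylinder_split => [|s|s]; first exact: measurable_change.
    exact: iter_visits_ge0.
  rewrite muleA -cylinder_extend -addSnnS.
  by apply: le_trans (IHm _ _) _; rewrite /extend ltnn.
rewrite addn0 /= /visits; have [Bw|Bw] := asboolP (B (w n)).
  by rewrite mule1 measureIl//; [exact: measurable_cylinder|exact: measurable_change].
rewrite -[X in (_ * X)%E](mean_cst nu0 nu1 (lexx 0%E)).
apply: cylinder_split => // [|s]; first exact: measurable_change.
rewrite mule0 mule0; have [s0|s0] := eqVneq (nu s) 0.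
  apply: (@le_trans _ _ (P (cylinder n.+1 (extend n w s)))).
    by rewrite measureIl//; [exact: measurable_cylinder|exact: measurable_change].
  by rewrite cylinder_extend s0 mule0.
rewrite (_ : _ `&` _ = set0) ?measure0//; apply/seteqP; split => // x [xw].
by apply; rewrite !xw// /extend leqnn ltnn obs_const.
Qed.

Definition eventually_obs (c : T) : set (path_space W) :=
  [set x : trajectory W | exists N, forall n, (N <= n)%N -> obs (x n) = c].

Lemma measurable_eventually_obs c : measurable (eventually_obs c).
Proof.
rewrite (_ : eventually_obs c = \bigcup_N \bigcap_(n in [set n | (N <= n)%N])
    [set x : trajectory W | [set w | obs w = c] (x n)]).
  apply: bigcup_measurable => N _; apply: bigcap_measurableType => n _.
  exact: measurable_coord.
apply/seteqP; split => x.
  by move=> [N xN]; exists N => // n /= /xN.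
by move=> [N _ xN]; exists N => n Nn; exact: xN.
Qed.

Lemma eventually_obs_boundary c : boundary_events (eventually_obs c).
Proof.
split; first exact: measurable_eventually_obs.
move=> x y [N [k xy]] [M xM].
exists (N + M + absz k)%N => j jge.
have [] := xy (absz (j%:Z - k)); first lia.
move=> _; have -> : absz ((absz (j%:Z - k))%:Z + k) = j by lia.
by move=> <-; apply: xM; lia.
Qed.

(** Along a trajectory that follows [w] up to time [n], either [obs] keeps its
value forever or it changes at some later time; by the union bound the changes
have probability at most [green (w n)] times that of the beginning. *)
Lemma eventually_obs_gt0 n w : (0 < P (cylinder n w))%E -> (green (w n) < 1)%E ->
  (0 < P (eventually_obs (obs (w n))))%E.
Proof.
move=> Pc g1; rewrite lt0e measure_ge0 andbT; apply/eqP => P0.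
pose A k := if k is k'.+1 then cylinder n w `&` change (n + k')%N
  else eventually_obs (obs (w n)).
have mA k : measurable (A k).
  case: k => [|k]; first exact: measurable_eventually_obs.
  by apply: measurableI; [exact: measurable_cylinder|exact: measurable_change].
have sub : cylinder n w `<=` \bigcup_k A k.
  move=> x xw; have [[m ch]|noch] := pselect (exists m, change (n + m) x).
    by exists m.+1.
  exists 0%N => //; exists n => m nm; rewrite -(subnKC nm) -(xw n)//.
  elim: (m - n)%N => [|d IHd]; first by rewrite addn0.
  rewrite addnS -IHd; apply/esym; apply: contrapT => ch.
  by apply: noch; exists d.
have := measure_sigma_subadditive P mA (measurable_cylinder n w) sub.
apply/negP; rewrite -ltNge.
have Pfin : P (cylinder n w) \is a fin_num by exact: fin_num_measure (measurable_cylinder n w).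
apply: (@le_lt_trans _ _ (P (cylinder n w) * green (w n))%E); last first.
  by rewrite -[ltRHS]mule1 lte_pmul2l.
rewrite /green esumZl//; last by move=> m; exact: iter_visits_ge0.
rewrite -nneseries_esumT; last by move=> m; rewrite mule_ge0// iter_visits_ge0.
rewrite [leLHS](@nneseries_recl _ xpredT (fun k => P (A k)))// [X in (X + _)%E]P0 add0e.
rewrite -(nneseries_addn 1)//; under eq_eseriesr do rewrite addn1.
apply: lee_nneseries => // i _; exact: change_le_visits.
Qed.

Lemma cylinder_word_gt0 (l : seq W) : {in l, forall s, nu s != 0} ->
  (0 < P (cylinder (size l) (fun i => \prod_(s <- take i l) s)%g))%E.
Proof.
have [nu0 _] := nu_prob.
move=> lnu; rewrite P_law take0 big_nil eqxx mul1r lte_fin.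
apply: prodr_gt0 => i _; rewrite (take_nth 1%g)// -cats1 big_cat big_seq1 mulKg.
by rewrite lt0r nu0 lnu// mem_nth.
Qed.

Lemma obs_word_gt0 (l : seq W) : {in l, forall s, nu s != 0} ->
  (green (\prod_(s <- l) s)%g < 1)%E ->
  (0 < P (eventually_obs (obs (\prod_(s <- l) s)%g)))%E.
Proof.
move=> /cylinder_word_gt0 lP g1.
by have := eventually_obs_gt0 lP; rewrite take_size; exact.
Qed.

End BoundaryCriterion.

(** If two positions that the walk can reach differ in [obs] and each is
followed by less than one expected visit to [B], then with positive probability
the value of [obs] at either of them becomes permanent. *)
Lemma boundary_criterion (R : realType) (W : groupType) (nu : W -> R) (T : Type)
    (obs : W -> T) (B : set W) (l1 l2 : seq W) :
  countable [set: W] -> is_prob nu ->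
  (forall w s, ~ B w -> nu s != 0 -> obs (w * s)%g = obs w) ->
  {in l1, forall s, nu s != 0} -> {in l2, forall s, nu s != 0} ->
  (green nu B (\prod_(s <- l1) s)%g < 1)%E ->
  (green nu B (\prod_(s <- l2) s)%g < 1)%E ->
  obs (\prod_(s <- l1) s)%g <> obs (\prod_(s <- l2) s)%g ->
  nontrivial_boundary nu.
Proof.
move=> W_countable nu_prob obs_const nu1 nu2 g1 g2 obs12.
have [code [decode [codeK decodeK]]] := countable_code W_countable.
have [P P_law] := walk_law_exists nu_prob codeK decodeK.
exists P; split => //.
pose E := eventually_obs obs; set c1 := obs _ in obs12; set c2 := obs _ in obs12.
exists (E c1); split; first exact: eventually_obs_boundary.
have P1 : (0 < P (E c1))%E by exact: obs_word_gt0 g1.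
have P2 : (0 < P (E c2))%E by exact: obs_word_gt0 g2.
rewrite P1 ltNge; apply/negP => P1ge.
have mE c : measurable (E c) by exact: measurable_eventually_obs.
have dis : E c1 `&` E c2 = set0.
  apply/seteqP; split => // x [[N1 x1] [N2 x2]]; apply: obs12.
  by rewrite -(x1 (N1 + N2)%N) ?leq_addr// x2// leq_addl.
have := probability_le1 P (measurableU _ _ (mE c1) (mE c2)).
rewrite measureU//; apply/negP; rewrite -ltNge.
apply: le_lt_trans P1ge _; rewrite lteDl// ge0_fin_numE//.
by apply: le_lt_trans (probability_le1 P (mE c1)) _; rewrite ltry.
Qed.

(** Moving the start along the walk for [N] steps drops the first [N] terms of
the series of expected visits on average, so not all positions reached can keep
an expectation at least [1]. *)
Lemma green_small (R : realType) (W : groupType) (nu : W -> R) (B : set W) :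
  is_prob nu -> (green nu B 1%g < +oo)%E ->
  exists2 l : seq W, {in l, forall s, nu s != 0} &
    (green nu B (\prod_(s <- l) s)%g < 1)%E.
Proof.
move=> nu_prob goo; have [nu0 nu1] := nu_prob.
apply: contrapT => no.
have green_ge1 l : {in l, forall s, nu s != 0} ->
    (1 <= green nu B (\prod_(s <- l) s)%g)%E.
  by move=> lnu; rewrite leNgt; apply/negP => lt; apply: no; exists l.
have green0 w : (0 <= green nu B w)%E.
  by apply: esum_ge0 => m _; exact: iter_visits_ge0.
have iter0 n w : (0 <= iter n (step_mean nu) (green nu B) w)%E.
  by elim: n w => [//|n IHn] w; exact: step_mean_ge0.
(* As long as the walk follows steps of positive weight it sees only values of
   the Green function that are at least 1, so its averages are at least 1 too. *)
have iter_ge1 n l : {in l, forall s, nu s != 0} ->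
    (1 <= iter n (step_mean nu) (green nu B) (\prod_(s <- l) s)%g)%E.
  elim: n l => [|n IHn] l lnu; first exact: green_ge1.
  rewrite iterS -(mean_cst nu0 nu1 (@lee01 R)); apply: le_esum => s _.
  have [->|s0] := eqVneq (nu s) 0; first by rewrite !mul0e.
  apply: lee_wpmul2l; first by rewrite lee_fin.
  have -> : (\prod_(t <- l) t * s = \prod_(t <- rcons l s) t)%g.
    by rewrite -cats1 big_cat big_seq1.
  by apply: IHn => t; rewrite mem_rcons inE => /predU1P[->//|]; exact: lnu.
have iterE n w : iter n (step_mean nu) (green nu B) w =
    (\esum_(m in [set: nat]) iter (n + m) (step_mean nu) (visits R B) w)%E.
  elim: n w => [//|n IHn] w; rewrite iterS /step_mean.
  rewrite (eq_mean _ (fun s => IHn (w * s)%g)) mean_esum// => m s.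
  exact: iter_visits_ge0.
have := @nneseries_tail_cvg R (fun m => iter m (step_mean nu) (visits R B) 1%g) xpredT.
rewrite nneseries_esumT; last by move=> m; exact: iter_visits_ge0.
move=> /(_ goo (fun m _ => iter_visits_ge0 nu_prob B m _)) tail.
have : (1 <= 0 :> \bar R)%E; last by rewrite lee_fin ler10.
rewrite -(cvg_lim _ tail)//; apply: lime_ge; first by apply/cvg_ex; exists 0%E.
near=> N.
have : (1 <= iter N (step_mean nu) (green nu B) 1%g)%E.
  by have := @iter_ge1 N [::]; rewrite big_nil; apply => s; rewrite in_nil.
rewrite iterE.
rewrite -nneseries_esumT; last by move=> m; exact: iter_visits_ge0.
rewrite -(nneseries_addn N); last by move=> m; exact: iter_visits_ge0.
by under eq_eseriesr do rewrite addnC.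
Unshelve. all: by end_near. Qed.

(** * Generators of permutational wreath products *)

Lemma sub_generated (K : groupType) (S : set K) : S `<=` generated S.
Proof. by apply: sub_smallest => x. Qed.

Lemma generated_subgroup (K : groupType) (S : set K) : is_subgroup (generated S).
Proof.
split; first by move=> H [[]].
by move=> g h Sg Sh H HS; have [[_ HM] _] := HS; apply: HM; [exact: Sg|exact: Sh].
Qed.

Lemma subgroupM (K : groupType) (H : set K) g h : is_subgroup H ->
  H g -> H h -> H (g * h)%g.
Proof.
move=> [H1 HM] Hg Hh; rewrite -[h]invgK; apply: (HM) => //.
by rewrite -[(h^-1)%g]mul1g; exact: HM.
Qed.

Lemma subgroupV (K : groupType) (H : set K) g : is_subgroup H -> H g -> H (g^-1)%g.
Proof. by move=> [H1 HM] Hg; rewrite -[(g^-1)%g]mul1g; exact: HM. Qed.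

(** The preimage of a subgroup is a subgroup. *)
Lemma generated_preimage (K L : groupType) (S : set K) (H : set L) (f : K -> L) :
  generated S = [set: K] -> is_subgroup H ->
  (forall g h, f (g * h)%g = (f g * f h)%g) -> (forall s, S s -> H (f s)) ->
  forall g, H (f g).
Proof.
move=> gS HH fM SH g; have : generated S g by rewrite gS.
have f1 : f 1%g = 1%g by apply: (mulgI (f 1%g)); rewrite -fM !mulg1.
have fV h : f (h^-1)%g = ((f h)^-1)%g.
  by apply: (mulgI (f h)); rewrite -fM !mulgV.
apply: (@smallest_sub _ _ _ [set g | H (f g)]) => //; split => /=.
  by rewrite f1; case: HH.
by move=> x y Hx Hy; rewrite fM fV; case: HH => _; exact.
Qed.

Section Wreath.
Variables (A G : groupType) (X : Type) (a : right_action G X).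
Local Notation W := (wreath A a).

Definition walker (g : G) : W := Wreath a g (finite_lamps1 A X).

Lemma finite_lamp (x : X) (c : A) :
  finite_set [set y | (if `[< y = x >] then c else 1)%g != 1%g].
Proof.
apply: (sub_finite_set _ (finite_set1 x)) => y /=.
by case: asboolP => //; rewrite eqxx.
Qed.

Definition lamp (x : X) (c : A) : W := Wreath a 1%g (finite_lamp x c).

Lemma lampE x c y : lamps (lamp x c) y = if `[< y = x >] then c else 1%g.
Proof. by []. Qed.

Lemma lamp_id x c : lamps (lamp x c) x = c.
Proof. by rewrite lampE asboolT. Qed.

Lemma lamp_out x c y : y <> x -> lamps (lamp x c) y = 1%g.
Proof. by move=> yx; rewrite lampE asboolF. Qed.

Lemma lampsM (u v : W) x : lamps (u * v)%g x = (lamps u x * lamps v (a x (base u)))%g.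
Proof. by []. Qed.

Lemma baseM (u v : W) : base (u * v)%g = (base u * base v)%g.
Proof. by []. Qed.

Lemma walkerM g h : walker (g * h)%g = (walker g * walker h)%g.
Proof. by apply: wreath_eq => [x|] //=; rewrite mulg1. Qed.

Lemma walker1 : walker 1%g = 1%g.
Proof. by apply: wreath_eq. Qed.

Lemma walkerV g : walker (g^-1)%g = ((walker g)^-1)%g.
Proof. by apply: (mulgI (walker g)); rewrite -walkerM !mulgV walker1. Qed.

Lemma walker_inj : injective walker.
Proof. by move=> g h /(congr1 (@base _ _ _ _)). Qed.

Lemma lampM x c d : lamp x (c * d)%g = (lamp x c * lamp x d)%g.
Proof.
apply: wreath_eq => [y|] /=; last by rewrite mulg1.
by rewrite act1; case: asboolP; rewrite ?mulg1.
Qed.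

Lemma lamp1 x : lamp x 1%g = 1%g.
Proof. by apply: wreath_eq => [y|] //=; case: asboolP. Qed.

Lemma lampV x c : lamp x (c^-1)%g = ((lamp x c)^-1)%g.
Proof. by apply: (mulgI (lamp x c)); rewrite -lampM !mulgV lamp1. Qed.

Lemma lamp_conj x c g :
  lamp (a x g) c = ((walker g)^-1 * lamp x c * walker g)%g.
Proof.
rewrite -walkerV; apply: wreath_eq => [y|] /=; last by rewrite mulg1 mulVg.
rewrite mul1g mulg1; congr (if _ then _ else _); apply/asboolP/asboolP.
  by move=> ->; rewrite -actM mulgV act1.
by move=> <-; rewrite -actM mulVg act1.
Qed.

Lemma wreath_decomp (w : W) :
  exists v : W, base v = 1%g /\ w = (v * walker (base w))%g.
Proof.
exists (Wreath a 1%g (finite_lamps w)); split => //.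
by apply: wreath_eq => [x|] /=; rewrite ?mulg1 ?mul1g.
Qed.

(** A lamp anywhere is conjugate under a walker to a lamp at a chosen point of
its orbit, and every configuration is a product of lamps. *)
Lemma finitely_generated_wreath : finitely_generated G -> finitely_generated A ->
  finitely_many_orbits a -> finitely_generated W.
Proof.
move=> [S [fS gS]] [T [fT gT]] fO.
have [[x0 _]|X0] := pselect ([set: X] !=set0); last first.
  exists (walker @` S); split; first exact: finite_image.
  apply/seteqP; split => // w _.
  have -> : w = walker (base w).
    by apply: wreath_eq => // x; case: X0; exists x.
  apply: (generated_preimage gS (generated_subgroup _) walkerM) => s Ss.
  by apply: sub_generated; exists s.
pose rep (O : set X) : X := if pselect (O !=set0) is left e then projT1 (cid e) else x0.
pose reps := rep @` range (action_orbit a).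
have freps : finite_set reps by exact: finite_image.
pose U : set W := walker @` S `|` [set lamp x c | x in reps & c in T].
exists U; split.
  by rewrite finite_setU; split; [exact: finite_image|exact: finite_image2].
have HU := generated_subgroup U.
have Uwalker g : generated U (walker g).
  apply: (generated_preimage gS HU walkerM) => s Ss.
  by apply: sub_generated; left; exists s.
have Ulamp x c : generated U (lamp x c).
  have [g xg] : exists g, rep (action_orbit a x) = a x g.
    rewrite /rep; case: pselect => [e|[]]; last by exists (a x 1%g), 1%g.
    by case: cid => _ /= [g _ <-]; exists g.
  have -> : x = a (rep (action_orbit a x)) (g^-1)%g by rewrite xg -actM mulgV act1.
  rewrite lamp_conj; apply: (subgroupM HU) => //; apply: (subgroupM HU) => //.
    exact: (subgroupV HU).
  apply: (generated_preimage gT HU (lampM _)) => d Td.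
  apply: sub_generated; right; exists (rep (action_orbit a x)); last by exists d.
  by exists (action_orbit a x) => //; exists x.
apply/seteqP; split => // w _.
have [v [v1 ->]] := wreath_decomp w; apply: (subgroupM HU) => //.
have [l vl] : exists l : seq {classic X}, [set x : {classic X} | lamps v x != 1%g] = [set` l].
  by apply/finite_seqP; exact: finite_lamps.
have {vl} : forall x, lamps v x != 1%g -> (x : {classic X}) \in l.
  by move=> x vx; have : [set` l] x by rewrite -vl.
elim: l v v1 {w} => [|x l IHl] v v1 vl.
  suff -> : v = 1%g by case: HU.
  apply: wreath_eq => //= x; apply/eqP; apply: contraT => /vl.
  by rewrite in_nil.
have -> : v = (lamp x (lamps v x) * ((lamp x (lamps v x))^-1 * v))%g by rewrite mulVKg.
apply: (subgroupM HU) => //; apply: IHl; first by rewrite -lampV baseM /= v1 mulg1.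
move=> y; rewrite -lampV lampsM /= act1; case: asboolP => [->|yx].
  by rewrite mulVg eqxx.
rewrite mul1g => /vl; rewrite inE => /orP[/eqP|//].
by move=> /yx.
Qed.

End Wreath.

(** * The walk that moves or switches a lamp *)

Section WalkSwitch.
Context {R : realType}.
Variables (A G : groupType) (X : Type) (a : right_action G X).
Local Notation W := (wreath A a).
Local Open Scope ereal_scope.

Definition switch (u : W) (w : W) : R := ((w == u)%:R / 2 + (w == u^-1)%g%:R / 2)%R.

Definition push (p : G -> R) (w : W) : R :=
  if `[< w = walker A a (base w) >] then p (base w) else 0%R.

Lemma push_walker p g : push p (walker A a g) = p g.
Proof. by rewrite /push asboolT. Qed.

Lemma push_ge0 p w : (forall g, 0 <= p g)%R -> (0 <= push p w)%R.
Proof. by rewrite /push; case: asboolP. Qed.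

Lemma mean_push p F : mean (push p) F = mean p (fun g => F (walker A a g)).
Proof.
rewrite /mean (esum_inj (@walker_inj A G X a)).
  by apply: eq_esum => g _; rewrite push_walker.
move=> w nw; rewrite /push asboolF ?mul0e// => wE.
by apply: nw; exists (base w).
Qed.

Lemma switch_ge0 u w : (0 <= switch u w)%R.
Proof. by rewrite addr_ge0// divr_ge0. Qed.

Lemma mean_switch u F : (forall w, 0 <= F w) ->
  mean (switch u) F = (2^-1)%:E * (F u + F (u^-1)%g).
Proof.
move=> F0; transitivity (\esum_(w in [set: W]) (
    ((w == u)%:R / 2)%:E * F w + ((w == u^-1)%g%:R / 2)%:E * F w)).
  by apply: eq_esum => w _; rewrite /switch EFinD ge0_muleDl// lee_fin divr_ge0.
have pos v w : 0 <= ((w == v :> W)%:R / 2 : R)%:E * F w.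
  by rewrite mule_ge0// lee_fin divr_ge0.
rewrite esumD//.
rewrite (esum_single (t := u))//; last by move=> w /negbTE ->; rewrite mul0r mul0e.
rewrite (esum_single (t := u^-1%g))//; last by move=> w /negbTE ->; rewrite mul0r mul0e.
by rewrite !eqxx div1r ge0_muleDr.
Qed.

Lemma sum1_mean (T : choiceType) (p : T -> R) :
  mean p (fun=> 1) = 1 -> \esum_(t in [set: T]) (p t)%:E = 1.
Proof. by move=> <-; apply: eq_esum => t _; rewrite mule1. Qed.

Variables (mu : G -> R) (rho : X) (b : A) (q : R).
Hypotheses (mu_prob : is_prob mu) (q_gt0 : (0 < q)%R) (q_lt1 : (q < 1)%R).

(** Index [0] leaves the base in place: its weight is spent on switching the
lamp at [rho]. *)
Definition jump0 i : nat := if i is 0 then 0 else (2 ^ i)%N.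

Definition walk_switch_part i : W -> R :=
  if i is 0 then switch (lamp a rho b) else push (conv_pow mu (jump0 i)).

(** A step either switches the lamp at the point of [X] that the walker sees as
[rho], or moves the base. Its base therefore performs exactly the walk of
[jump_step mu q jump0]. *)
Definition walk_switch : W -> R := mixture (geom_weight q) walk_switch_part.

Local Notation c0 := (geom_weight_ge0 q_gt0 q_lt1).
Local Notation c1 := (geom_weight_sum1 q_gt0 q_lt1).

Lemma walk_switch_part_prob i : is_prob (walk_switch_part i).
Proof.
case: i => [|i]; split => [w|].
- exact: switch_ge0.
- apply: sum1_mean; rewrite mean_switch// -EFinD -EFinM; congr (_%:E).
  by field.
- by apply: push_ge0 => g; exact: conv_pow_ge0.
- apply: sum1_mean; rewrite mean_push mean_cst//; first exact: conv_pow_ge0.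
  by case: (is_prob_conv_pow mu_prob (jump0 i.+1)).
Qed.

Local Notation part0 := (fun i => (walk_switch_part_prob i).1).
Local Notation part1 := (fun i => (walk_switch_part_prob i).2).

Lemma walk_switch_prob : is_prob walk_switch.
Proof.
split => [w|].
  by apply: mixture_ge0; [exact: c0|exact: c1|exact: part0|exact: part1].
by apply: mixture_sum1; [exact: c0|exact: c1|exact: part0|exact: part1].
Qed.

Lemma mean_walk_switch F : (forall w, 0 <= F w) ->
  mean walk_switch F = mean (geom_weight q) (fun i => mean (walk_switch_part i) F).
Proof.
by apply: mean_mixture; [exact: c0|exact: c1|exact: part0|exact: part1].
Qed.

Lemma walk_switch_symmetric : symmetric_measure mu -> symmetric_measure walk_switch.
Proof.
move=> mu_sym w; rewrite /walk_switch /mixture; congr fine.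
apply: eq_mean => i; congr (_%:E); case: i => [|i] /=.
  by rewrite /switch eqg_inv eqg_invLR addrC.
rewrite /push; case: asboolP => [wE|wE].
  rewrite asboolT; first exact: conv_pow_symmetric.
  by rewrite {1}wE -walkerV.
rewrite asboolF// => wE'; apply: wE; apply: invg_inj.
by rewrite wE' -walkerV.
Qed.

Lemma step_mean_walk_switch (F : G -> \bar R) w : (forall g, 0 <= F g) ->
  step_mean walk_switch (fun v => F (base v)) w = jump_step mu q jump0 F (base w).
Proof.
move=> F0; rewrite /step_mean mean_walk_switch//.
apply: eq_mean => -[|i] /=; last by rewrite mean_push.
rewrite mean_switch// /step_mean mean_conv_pow0//= invg1 !mulg1.
rewrite ge0_muleDr// -ge0_muleDl ?lee_fin ?invr_ge0// -EFinD.
by rewrite (_ : _ + _ = 1)%R ?mul1e//; field.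
Qed.

Lemma iter_step_mean_walk_switch m (F : G -> \bar R) w : (forall g, 0 <= F g) ->
  iter m (step_mean walk_switch) (fun v => F (base v)) w =
  iter m (jump_step mu q jump0) F (base w).
Proof.
move=> F0; elim: m w => [//|m IHm] w /=.
rewrite -step_mean_walk_switch; last by move=> g; exact: iter_jump_step_ge0.
by apply: eq_mean => s; rewrite IHm.
Qed.

Lemma walk_switch_lamps s x : walk_switch s != 0%R -> x <> rho -> lamps s x = 1%g.
Proof.
move=> nus xrho; apply: contrapT => sx; move/eqP: nus; apply.
rewrite /walk_switch /mixture /mean esum1// => -[|i] _ /=.
  rewrite /switch; case: eqP => [sE|_].
    by case: sx; rewrite sE lamp_out.
  case: eqP => [sE|_]; last by rewrite !mul0r addr0 mule0.
  by case: sx; rewrite sE -lampV lamp_out.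
by rewrite /push asboolF ?mule0// => sE; case: sx; rewrite sE.
Qed.

Lemma walk_switch_lamp : walk_switch (lamp a rho b) != 0%R.
Proof.
rewrite gt_eqF// -lte_fin [ltRHS]mixtureE; [|exact: c0|exact: c1|exact: part0|exact: part1].
apply: (@lt_le_trans _ _ ((geom_weight q 0)%:E * (switch (lamp a rho b) (lamp a rho b))%:E)).
  rewrite -EFinM lte_fin mulr_gt0 ?geom_weight_gt0//.
  by rewrite /switch eqxx ltr_wpDr// ?divr_ge0// divr_gt0.
apply: (@esum_ge_term _ _ (fun i => (geom_weight q i)%:E * (walk_switch_part i _)%:E) 0%N).
by move=> i; rewrite -EFinM lee_fin mulr_ge0 ?geom_weight_ge0// part0.
Qed.

End WalkSwitch.

Section BoundaryWreath.
Variables (R : realType) (A G : groupType) (X : Type) (a : right_action G X).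
Variables (mu : G -> R) (rho : X) (b : A) (q : R).
Hypotheses (mu_prob : is_prob mu) (q_gt0 : 0 < q) (q_lt1 : q < 1).

Definition at_home (g : G) : \bar R := (`[< stab a rho g >])%:R%:E.

Lemma at_home_ge0 g : (0 <= at_home g)%E.
Proof. by rewrite lee_fin. Qed.

Lemma mean_at_home n :
  mean (conv_pow mu n) at_home = (\esum_(g in stab a rho) (conv_pow mu n g)%:E)%E.
Proof.
rewrite [RHS]esum_mkcond; apply: eq_esum => g _; rewrite /at_home.
case: asboolP => [ag|ag]; first by rewrite mem_set// mule1.
by rewrite memNset// mule0.
Qed.

(** The lamp at [rho] changes only while the base is in the stabiliser of
[rho]. A position with less than one expected further visit there exists, and
so does its translate by a switch, which has the same base but another lamp at
[rho]. *)
Lemma walk_switch_boundary : countable [set: wreath A a] -> b != 1%g ->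
  (\esum_(m in [set: nat]) iter m (jump_step mu q jump0) at_home 1%g < +oo)%E ->
  nontrivial_boundary (@walk_switch R A G X a mu rho b q).
Proof.
move=> W_countable b1 goo.
pose nu := @walk_switch R A G X a mu rho b q.
have nu_prob : is_prob nu by exact: walk_switch_prob.
pose B : set (wreath A a) := [set w | stab a rho (base w)].
have greenE w : green nu B w =
    (\esum_(m in [set: nat]) iter m (jump_step mu q jump0) at_home (base w))%E.
  apply: eq_esum => m _; rewrite -(iter_step_mean_walk_switch rho b mu_prob)//.
  exact: at_home_ge0.
have [|l lnu lg] := @green_small R _ nu B nu_prob; first by rewrite greenE.
pose w := (\prod_(s <- l) s)%g; pose beta := lamp a rho b.
apply: (@boundary_criterion R _ nu _ (fun w => lamps w rho) B (beta :: l) l) => //.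
- move=> v s Bv nus; rewrite lampsM (walk_switch_lamps nus) ?mulg1//.
- by move=> s; rewrite inE => /predU1P[->|/lnu//]; exact: walk_switch_lamp.
- by rewrite big_cons greenE baseM/= mul1g -greenE.
- rewrite big_cons lampsM /= asboolT// act1 -[RHS]mul1g => /mulIg b1'.
  by rewrite b1' eqxx in b1.
Qed.

End BoundaryWreath.

(** * Paths with many fresh departures *)

Section FreshPositions.
Variables (G : groupType) (X : Type) (a : right_action G X) (rho : X).

(** A walker with base [g] can switch the lamp at [rho g^-1]. It can switch the
same lamp again exactly after steps whose product is in the stabiliser of
[rho]. *)
Definition fresh (hs : seq G) : bool :=
  `[< forall i, (i < size hs)%N -> ~ stab a rho (\prod_(h <- take i.+1 hs) h)%g >].

Fixpoint nb_fresh (hs : seq G) : nat :=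
  if hs is _ :: hs' then (fresh hs + nb_fresh hs')%N else 0%N.

Fixpoint nb_stale (hs : seq G) : nat :=
  if hs is _ :: hs' then (~~ fresh hs + nb_stale hs')%N else 0%N.

Lemma nb_fresh_stale hs : (nb_fresh hs + nb_stale hs = size hs)%N.
Proof. by elim: hs => //= h hs <-; case: fresh => /=; lia. Qed.

End FreshPositions.

Section CheapPath.
Variables (R : realType) (G : groupType) (X : Type) (a : right_action G X) (rho : X).
Variables (mu : G -> R) (q : R) (jump : nat -> nat).
Hypotheses (mu_prob : is_prob mu) (q_gt0 : 0 < q) (q_lt1 : q < 1).
Local Notation K := (jump_step mu q jump).
Local Notation home := (at_home R a rho).
Local Notation c0 := (geom_weight_ge0 q_gt0 q_lt1).
Local Notation c1 := (geom_weight_sum1 q_gt0 q_lt1).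
Local Notation K0 := (jump_step_ge0 mu_prob jump q_gt0 q_lt1).
Local Notation iterK0 := (iter_jump_step_ge0 mu_prob jump q_gt0 q_lt1).

Lemma jump_step_lt_exists F g (c : \bar R) : (forall h, 0 <= F h)%E -> (0 <= c)%E ->
  (K F g < c)%E -> exists h, (F (g * h)%g < c)%E.
Proof.
move=> F0 cge0 /(mean_lt_exists c0 c1 cge0)[i _].
have [p0 p1] := is_prob_conv_pow mu_prob (jump i).
by move=> /(mean_lt_exists p0 p1 cge0)[h _ ?]; exists h.
Qed.

Lemma jump_stepD F1 F2 g : (forall h, 0 <= F1 h)%E -> (forall h, 0 <= F2 h)%E ->
  K (fun h => F1 h + F2 h)%E g = (K F1 g + K F2 g)%E.
Proof.
move=> F10 F20; have cp := conv_pow_ge0 mu_prob.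
rewrite /jump_step -meanD//; [|exact: c0|by move=> i; exact: step_mean_ge0..].
by apply: eq_mean => i; rewrite /step_mean meanD.
Qed.

Lemma iter_jump_stepD m F1 F2 g : (forall h, 0 <= F1 h)%E -> (forall h, 0 <= F2 h)%E ->
  iter m K (fun h => F1 h + F2 h)%E g = (iter m K F1 g + iter m K F2 g)%E.
Proof.
move=> F10 F20; elim: m g => [//|m IHm] g /=.
rewrite -jump_stepD; [|by move=> h; exact: iterK0..].
by congr (K _ g); apply/funext.
Qed.

Lemma jump_step_sum m (F : nat -> G -> \bar R) g : (forall j h, 0 <= F j h)%E ->
  K (fun h => \sum_(j < m) F j h)%E g = (\sum_(j < m) K (F j) g)%E.
Proof.
move=> F0; elim: m => [|m IHm].
  rewrite big_ord0 /jump_step /mean esum1// => i _.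
  rewrite /step_mean /mean esum1 ?mule0// => h _.
  by rewrite big_ord0 mule0.
rewrite big_ord_recr/= -IHm -jump_stepD//; last by move=> h; exact: sume_ge0.
by congr (K _ g); apply/funext => h; rewrite big_ord_recr.
Qed.

Lemma iter_jump_step_translate m F h g :
  iter m K (fun k => F (h * k)%g) g = iter m K F (h * g)%g.
Proof.
elim: m g => [//|m IHm] g /=; apply: eq_mean => i; apply: eq_mean => k.
by rewrite IHm mulgA.
Qed.

(** A departure that is not fresh is paid for by one of its returns. *)
Lemma fresh_cons h hs : ((~~ fresh a rho (h :: hs))%:R%:E <=
  \sum_(j < (size hs).+1) home (h * \prod_(k <- take j hs) k)%g)%E.
Proof.
rewrite /fresh; case: asboolP => /= [_|]; first by apply: sume_ge0 => j _; exact: at_home_ge0.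
move=> /existsNP[i /not_implyP[ihs /contrapT ai]].
have homei : home (h * \prod_(k <- take i hs) k)%g = 1%E.
  by rewrite /at_home asboolT//; move: ai; rewrite /= big_cons.
rewrite (bigD1 (Ordinal ihs))//= homei.
by rewrite leeDl//; apply: sume_ge0 => j _; exact: at_home_ge0.
Qed.

Variables (cost : G -> nat) (eps theta : R).
Hypothesis eps_ge0 : 0 <= eps.
Hypothesis mean_le_theta : forall m,
  (K (fun h => (eps * (cost h)%:R)%:E) 1%g + \sum_(j < m) iter j.+1 K home 1%g <=
   theta%:E)%E.

(** The method of conditional expectations. Charge a path [eps] times the costs
of its steps and [1] for each departure that is not fresh; the expected charge
of [m] steps is at most [m * theta], so some path is that cheap. Steps are
chosen one at a time, each not raising the expected charge of the rest. For the
induction [phi g] is an extra charge for a position [g] relative to the start;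
it records the possible returns to the places left behind. *)
Lemma cheap_path m (phi : G -> nat) (y : R) :
  ((m%:R * theta)%:E + \sum_(j < m.+1) iter j K (fun g => (phi g)%:R%:E) 1%g < y%:E)%E ->
  exists2 hs : seq G, size hs = m &
    \sum_(h <- hs) eps * (cost h)%:R + (nb_stale a rho hs)%:R +
    \sum_(j < m.+1) (phi (\prod_(h <- take j hs) h)%g)%:R < y.
Proof.
elim: m phi y => [|m IHm] phi y.
  rewrite mul0r add0e big_ord1 lte_fin => phiy; exists [::] => //.
  by rewrite big_nil !add0r big_ord1 big_nil.
have phi0 (psi : G -> nat) g : (0 <= (psi g)%:R%:E :> \bar R)%E by rewrite lee_fin.
rewrite big_ord_recl; set s1 : \bar R := (\sum_(i < m.+1) _)%E.
have s10 : (0 <= s1)%E by apply: sume_ge0 => j _; exact: iterK0.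
move=> s1y.
have [r rE] : exists r : R, s1 = r%:E.
  by case: s1 s10 s1y => [r||] // _; exists r.
(* Seen from after the first step, the start is one more place not to return to. *)
pose psi g : nat := (`[< stab a rho g >] + phi g)%N.
pose f h := ((eps * (cost h)%:R)%:E + \sum_(j < m.+1) iter j K (fun g => (psi g)%:R%:E) h)%E.
have psiE j g : iter j K (fun g => (psi g)%:R%:E) g =
    (iter j K home g + iter j K (fun g => (phi g)%:R%:E) g)%E.
  rewrite -iter_jump_stepD//; last by move=> h; exact: at_home_ge0.
  by congr (iter j K _ g); apply/funext => h; rewrite -EFinD -natrD.
have f0 h : (0 <= f h)%E.
  rewrite adde_ge0 ?lee_fin ?mulr_ge0//; apply: sume_ge0 => j _; exact: iterK0.
have Kf : (K f 1%g <= (theta + r)%:E)%E.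
  rewrite jump_stepD; last 2 first.
  - by move=> h; rewrite lee_fin mulr_ge0.
  - by move=> h; apply: sume_ge0 => j _; exact: iterK0.
  rewrite jump_step_sum; last by move=> j h; exact: iterK0.
  under eq_bigr => j _ do rewrite -iterS psiE.
  by rewrite big_split/= addeA EFinD; apply: leeD; [exact: mean_le_theta|rewrite -rE].
have {}s1y : theta + r < y - m%:R * theta - (phi 1%g)%:R.
  move: s1y; rewrite rE /= -!EFinD lte_fin -natr1; lra.
have Kfy : (K f 1%g < (y - m%:R * theta - (phi 1%g)%:R)%:E)%E.
  by apply: le_lt_trans Kf _; rewrite lte_fin.
have [|h] := jump_step_lt_exists f0 _ Kfy.
  by apply: ltW; apply: le_lt_trans Kfy; exact: K0.
rewrite mul1g /f => fh.
have [|hs shs hsy] := IHm (fun g => psi (h * g)%g) (y - eps * (cost h)%:R - (phi 1%g)%:R).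
  under eq_bigr => j _ do
    rewrite (iter_jump_step_translate j (fun g => (psi g)%:R%:E)) mulg1.
  move: fh; case: (\sum_(j < _) _)%E => [z||] //=.
    by rewrite -!EFinD !lte_fin; lra.
  by move=> _; rewrite addeNy ltNyr.
exists (h :: hs); first by rewrite /= shs.
rewrite big_cons big_ord_recl /= big_nil.
have -> : \sum_(i < m.+1) (phi (\prod_(k <- h :: take (0 + i) hs) k)%g)%:R =
    \sum_(j < m.+1) (phi (h * \prod_(k <- take j hs) k)%g)%:R :> R.
  by apply: eq_bigr => j _; rewrite big_cons.
have := fresh_cons h hs; rewrite sumEFin lee_fin shs => frle.
have psiS : \sum_(j < m.+1) (psi (h * \prod_(k <- take j hs) k)%g)%:R =
    \sum_(j < m.+1) (`[< stab a rho (h * \prod_(k <- take j hs) k)%g >])%:R +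
    \sum_(j < m.+1) (phi (h * \prod_(k <- take j hs) k)%g)%:R :> R.
  by rewrite -big_split/=; apply: eq_bigr => j _; rewrite natrD.
by move: hsy frle; rewrite psiS natrD; lra.
Qed.

End CheapPath.

Section SwitchChoices.
Variables (A G : groupType) (X : Type) (a : right_action G X) (rho : X) (b : A).
Hypothesis b_neq1 : b != 1%g.
Local Notation W := (wreath A a).
Local Notation fresh := (fresh a rho).
Local Notation nb_fresh := (nb_fresh a rho).

(** Only fresh departures offer a choice: elsewhere a later switch could undo
the effect of an earlier one. *)
Fixpoint switch_choices (hs : seq G) : seq W :=
  if hs is h :: hs' then
    let l := [seq (walker A a h * w)%g | w <- switch_choices hs'] in
    if fresh hs then l ++ [seq (lamp a rho b * w)%g | w <- l] else l
  else [:: 1%g].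

Lemma size_switch_choices hs : size (switch_choices hs) = (2 ^ nb_fresh hs)%N.
Proof.
elim: hs => //= h hs IHhs; case: fresh.
  by rewrite size_cat !size_map IHhs addnn -mul2n expnS.
by rewrite size_map IHhs.
Qed.

(** Only the lamps that the walker passes can be on. *)
Lemma switch_choices_lamps hs w y : w \in switch_choices hs -> lamps w y != 1%g ->
  exists2 j, (j < size hs)%N & a y (\prod_(h <- take j hs) h)%g = rho.
Proof.
elim: hs w y => [|h hs IHhs] w y.
  by rewrite inE => /eqP ->; rewrite eqxx.
pose l := [seq (walker A a h * w)%g | w <- switch_choices hs].
have inl v : v \in l -> lamps v y != 1%g ->
    exists2 j, (j < size (h :: hs))%N & a y (\prod_(h <- take j (h :: hs)) h)%g = rho.
  move=> /mapP[v' v'hs ->]; rewrite lampsM /= mul1g => /(IHhs _ _ v'hs)[j jhs yj].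
  by exists j.+1 => //; rewrite /= big_cons actM.
rewrite /=; case: ifP => _; last exact: inl.
rewrite mem_cat => /orP[|/mapP[v vl ->]]; first exact: inl.
have [->|yrho] := pselect (y = rho).
  by exists 0%N => //; rewrite big_nil act1.
by rewrite lampsM lamp_out// mul1g /= act1; exact: inl.
Qed.

(** The lamp at [rho] tells whether the first departure, if fresh, was preceded
by a switch: it is out of reach of the later switches. *)
Lemma uniq_switch_choices hs : uniq (switch_choices hs).
Proof.
elim: hs => //= h hs IHhs.
pose l := [seq (walker A a h * w)%g | w <- switch_choices hs].
have ul : uniq l by rewrite map_inj_uniq//; exact: mulgI.
case: ifPn => // /asboolP fr; rewrite cat_uniq ul map_inj_uniq ?ul ?andbT/=; last exact: mulgI.
have off w : w \in l -> lamps w rho = 1%g.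
  move=> /mapP[v vhs ->]; rewrite lampsM /= mul1g.
  apply/eqP; apply: contraT => /(switch_choices_lamps vhs)[j jhs aj].
  exfalso; apply: (fr j); first exact: ltnW.
  by rewrite /= big_cons /stab/= actM.
apply/negP => /hasP[_ /mapP[w wl ->] /off]; rewrite lampsM lamp_id /= act1 off// mulg1.
by move/eqP; rewrite (negbTE b_neq1).
Qed.

Lemma switch_choices_norm (S : set W) M hs w : generated S = [set: W] ->
  (forall h, h \in hs -> (word_norm S (walker A a h) <= M h)%N) ->
  w \in switch_choices hs ->
  (word_norm S w <= size hs * word_norm S (lamp a rho b) + \sum_(h <- hs) M h)%N.
Proof.
move=> gS; elim: hs w => [|h hs IHhs] w hM.
  by rewrite inE => /eqP ->; rewrite (word_norm1 gS).
have {}IHhs v : v \in switch_choices hs ->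
    (word_norm S v <= size hs * word_norm S (lamp a rho b) + \sum_(h <- hs) M h)%N.
  by apply: IHhs => k khs; apply: hM; rewrite inE khs orbT.
have hh := hM h (mem_head _ _).
pose l := [seq (walker A a h * w)%g | w <- switch_choices hs].
have inl v : v \in l -> (word_norm S v <=
    size hs * word_norm S (lamp a rho b) + \sum_(h <- h :: hs) M h)%N.
  move=> /mapP[v' /IHhs v'hs ->]; apply: leq_trans (word_normM gS _ _) _.
  by rewrite big_cons addnCA leq_add.
rewrite /= mulSn -addnA; case: ifP => _; last first.
  by move=> /inl /leq_trans; apply; exact: leq_addl.
rewrite mem_cat => /orP[/inl /leq_trans|/mapP[v /inl vl ->]].
  by apply; exact: leq_addl.
by apply: leq_trans (word_normM gS _ _) _; rewrite leq_add2l.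
Qed.

End SwitchChoices.

(** * First moment and growth of the wreath product *)

Section Scales.
Variable R : realType.

Lemma powR_pow2 (s : R) k : ((2 ^ k)%:R : R) `^ s = (2 `^ s) ^+ k.
Proof.
by rewrite natrX -powR_mulrn// -powRrM mulrC powRrM powR_mulrn// powR_ge0.
Qed.

Lemma powR_decay (s : R) k n : 0 <= s -> (2 ^ k <= n)%N ->
  n%:R `^ (- s) <= (2 `^ (- s)) ^+ k.
Proof.
move=> s0 kn; rewrite -powR_pow2 !powRN lef_pV2 ?posrE ?powR_gt0 ?ltr0n ?expn_gt0//.
  by rewrite ge0_ler_powR// ?nnegrE// ler_nat.
by rewrite (leq_trans _ kn)// expn_gt0.
Qed.

End Scales.

Section FirstMomentAndGrowth.
Variables (R : realType) (G A : groupType) (X : Type) (a : right_action G X).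
Variables (S : set G) (mu : G -> R) (D C r t q : R).
Hypotheses (S_gen : finite_generating_set S) (mu_prob : is_prob mu).
Hypotheses (q_gt0 : 0 < q) (q_lt1 : q < 1) (r_gt0 : 0 < r) (qr_lt1 : q * r < 1).
Hypotheses (t_ge0 : 0 <= t) (t_lt1 : t < 1) (t_ltq : t < q).
Hypotheses (C_ge0 : 0 <= C) (D_ge0 : 0 <= D).
Hypothesis drift_le : forall k, (drift S mu (2 ^ k) <= (D * r ^+ k)%:E)%E.
Variables (rho : X) (b : A).
Hypothesis b_neq1 : b != 1%g.
Local Notation home := (at_home R a rho).
Local Notation u := (fun n => mean (conv_pow mu n) home).
Hypothesis return_le : forall k n, (2 ^ k <= n)%N -> (u n <= (C * t ^+ k)%:E)%E.
Local Notation W := (wreath A a).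

Let q_ge0 : 0 <= q := ltW q_gt0.
Let r_ge0 : 0 <= r := ltW r_gt0.
Let q1_ge0 : 0 <= 1 - q. Proof. by rewrite subr_ge0 ltW. Qed.

Lemma first_momentE (K : groupType) (T : set K) (p : K -> R) :
  first_moment T p = mean p (fun g => (word_norm T g)%:R%:E).
Proof. by apply: eq_esum => g _; rewrite EFinM. Qed.

Lemma return_ge0 n : (0 <= u n)%E.
Proof. by apply: mean_ge0 => [g|g]; [exact: conv_pow_ge0|exact: at_home_ge0]. Qed.

Lemma return_le1 n : (u n <= 1)%E.
Proof.
have [p0 p1] := is_prob_conv_pow mu_prob n.
rewrite -[leRHS](mean_cst p0 p1 (@lee01 R)); apply: le_mean => // g.
by rewrite lee_fin; case: asbool.
Qed.

(** Summability of [t ^+ k / q ^+ k] is what makes the walk transient. *)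
Lemma green_jump0_lty :
  (\esum_(m in [set: nat]) iter m (jump_step mu q jump0) home 1%g < +oo)%E.
Proof.
have h0 := at_home_ge0 R a rho.
apply: (@le_lt_trans _ _ (1 + ((C + 1) / (q - t))%:E)%E); last by rewrite -EFinD ltry.
apply: le_trans (esum_nat_recl _) _; first by move=> m; exact: iter_jump_step_ge0.
apply: leeD; first by rewrite lee_fin; case: asbool.
under eq_esum => m _ do rewrite iter_jump_stepE//.
apply: green_bound_geom => // [|n|n|k n kn]; first by rewrite addr_ge0.
- exact: return_ge0.
- exact: return_le1.
(* C + 1 instead of C covers jumps of index 0, which do not move the base. *)
- case: k kn => [|k] kn.
    rewrite expr0 mulr1; apply: le_trans (return_le1 _) _.
    by rewrite lee_fin lerDr.
  apply: le_trans (return_le kn) _.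
  by rewrite lee_fin ler_wpM2r ?exprn_ge0// lerDl.
Qed.

(** Summability of [(q * r) ^+ i]: a jump of index [i] has mean length at most
[D * r ^+ i]. *)
Lemma walk_switch_first_moment (T : set W) : finite_generating_set T ->
  (first_moment T (walk_switch mu rho b q) < +oo)%E.
Proof.
move=> T_gen; have [M MP] := word_norm_lipschitz S_gen T_gen (@walkerM A G X a).
have N0 w : (0 <= (word_norm T w)%:R%:E :> \bar R)%E by rewrite lee_fin.
pose L : R := (word_norm T (lamp a rho b))%:R.
rewrite first_momentE mean_walk_switch//.
apply: (@le_lt_trans _ _ (\esum_(i in [set: nat]) (((1 - q) * L) * q ^+ i)%:E +
    \esum_(i in [set: nat]) (((1 - q) * (M%:R * D)) * (q * r) ^+ i)%:E)%E); last first.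
  rewrite lte_add_pinfty//; apply: esum_geom_lty; rewrite ?mulr_ge0//.
  by rewrite q_ge0.
rewrite -esumD; last 2 first.
- by move=> i _; rewrite lee_fin !mulr_ge0 ?exprn_ge0.
- by move=> i _; rewrite lee_fin !mulr_ge0 ?exprn_ge0 ?mulr_ge0.
apply: le_esum => i _; rewrite -EFinD.
have -> : (1 - q) * L * q ^+ i + (1 - q) * (M%:R * D) * (q * r) ^+ i =
    geom_weight q i * (L + M%:R * (D * r ^+ i)).
  by rewrite exprMn /geom_weight; ring.
rewrite [leRHS]EFinM; apply: lee_wpmul2l; first by rewrite lee_fin geom_weight_ge0.
have MD j : 0 <= M%:R * (D * r ^+ j) by rewrite !mulr_ge0 ?exprn_ge0.
case: i => [|i] /=.
  rewrite mean_switch// (word_normV T_gen.2) -EFinD -EFinM lee_fin.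
  rewrite (_ : 2^-1 * _ = L); first by rewrite lerDl.
  by rewrite /L; field.
rewrite mean_push; apply: (@le_trans _ _ (M%:R * (D * r ^+ i.+1))%:E); last first.
  by rewrite lee_fin lerDr.
apply: le_trans (_ : M%:R%:E * drift S mu (2 ^ i.+1) <= _)%E; last first.
  by rewrite EFinM; apply: lee_wpmul2l; rewrite ?lee_fin.
rewrite /drift first_momentE -meanZ ?lee_fin//; last exact: conv_pow_ge0.
apply: le_mean => g; first exact: conv_pow_ge0.
by rewrite -EFinM lee_fin -natrM ler_nat.
Qed.

Lemma small_pow (e : R) : 0 < e -> exists k, t ^+ k <= e.
Proof.
move=> e0; have : t ^+ n @[n --> \oo] --> (0 : R) by apply: cvg_expr; rewrite ger0_norm.
move/cvgrPdist_le => /(_ e e0) [k _ /(_ k (leqnn k))] /=.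
by rewrite sub0r normrN => /(le_trans (ler_norm _)) ?; exists k.
Qed.

Lemma iter_jump_step0 (jump : nat -> nat) m g :
  iter m (jump_step mu q jump) (fun=> 0%E) g = 0%E.
Proof.
elim: m g => [//|m IHm] g; rewrite iterS /jump_step /mean esum1// => i _.
rewrite /step_mean /mean esum1 ?mule0// => h _.
by rewrite IHm mule0.
Qed.

(** Doubling the lengths of all jumps [k0] times keeps the mean length finite
and makes the expected number of returns at most [1 / 2]. *)
Lemma wreath_switch_choices : exists c : nat, forall m, exists hs : seq G,
  (m <= nb_fresh a rho hs)%N /\
  (size hs + \sum_(h <- hs) word_norm S h <= c * m)%N.
Proof.
have [k0 tk0] : exists k, t ^+ k <= (q - t) / (2 * (C + 1)).
  by apply: small_pow; rewrite divr_gt0 ?subr_gt0// mulr_gt0// ltr_wpDl.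
pose jump i := (2 ^ (i + k0))%N.
(* L bounds the mean length of a jump; eps is such that this costs at most
   1 / 4, which together with the returns makes 3 / 4 per jump. *)
pose L := (1 - q) * (D * r ^+ k0) / (1 - q * r).
have qr0 : 0 <= q * r by rewrite mulr_ge0.
have L0 : 0 <= L.
  by rewrite /L divr_ge0 ?subr_ge0 ?(ltW qr_lt1)// !mulr_ge0 ?exprn_ge0.
pose eps := (4 * (L + 1))^-1.
have eps0 : 0 < eps by rewrite invr_gt0 mulr_gt0// ltr_wpDl.
have cost0 h : (0 <= (eps * (word_norm S h)%:R)%:E)%E.
  by rewrite lee_fin mulr_ge0// ltW.
have h0 := at_home_ge0 R a rho.
have mean_cost : (jump_step mu q jump (fun h => (eps * (word_norm S h)%:R)%:E) 1%g
    <= (1 / 4)%:E)%E.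
  apply: (@le_trans _ _ (eps * L)%:E); last first.
    by rewrite lee_fin /eps mulrC ler_pdivrMr ?mulr_gt0 ?ltr_wpDl//; lra.
  apply: (@le_trans _ _ (\esum_(i in [set: nat])
      ((eps * ((1 - q) * (D * r ^+ k0))) * (q * r) ^+ i)%:E)%E).
    apply: le_esum => i _.
    have -> : eps * ((1 - q) * (D * r ^+ k0)) * (q * r) ^+ i =
      geom_weight q i * (eps * (D * r ^+ (i + k0))).
      by rewrite /geom_weight exprMn exprD; ring.
    rewrite [leRHS]EFinM; apply: lee_wpmul2l; first by rewrite lee_fin geom_weight_ge0.
    apply: (@le_trans _ _ (eps%:E * drift S mu (jump i))%E).
      rewrite /drift first_momentE -meanZ ?lee_fin ?(ltW eps0)//.
      - by apply: le_mean => [g|g]; [exact: conv_pow_ge0|rewrite mul1g EFinM].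
      - exact: conv_pow_ge0.
    by rewrite EFinM; apply: lee_wpmul2l; [rewrite lee_fin ltW|exact: drift_le].
  apply: esum_nat_le => [i|n].
    by rewrite lee_fin !mulr_ge0 ?exprn_ge0 ?(ltW eps0).
  rewrite sumEFin lee_fin [leRHS]mulrA; apply: sum_geom_le; first by rewrite qr0.
  by rewrite !mulr_ge0 ?exprn_ge0 ?(ltW eps0).
have returns m : (\sum_(j < m) iter j.+1 (jump_step mu q jump) home 1%g <= (1 / 2)%:E)%E.
  apply: (@le_trans _ _ (\esum_(j in [set: nat]) iter j.+1 (jump_step mu q jump) home 1%g)%E).
    rewrite -nneseries_esumT; last by move=> j; exact: iter_jump_step_ge0.
    rewrite -(big_mkord xpredT (fun j => iter j.+1 (jump_step mu q jump) home 1%g)).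
    by apply: nneseries_lim_ge => j _ _; exact: iter_jump_step_ge0.
  under eq_esum => j _ do rewrite iter_jump_stepE//.
  apply: (@le_trans _ _ ((C * t ^+ k0) / (q - t))%:E); last first.
    rewrite lee_fin ler_pdivrMr ?subr_gt0//.
    have C1 : 0 < C + 1 by rewrite ltr_wpDl.
    apply: le_trans (ler_wpM2l C_ge0 tk0) _.
    rewrite mulrA ler_pdivrMr ?mulr_gt0//.
    have : 0 <= q - t by rewrite subr_ge0 ltW.
    nra.
  apply: green_bound_geom => // [|n|n|k n kn].
  - by rewrite mulr_ge0// exprn_ge0.
  - exact: return_ge0.
  - exact: return_le1.
  - by rewrite -mulrA -exprD addnC; exact: return_le.
have theta_le m : (jump_step mu q jump (fun h => (eps * (word_norm S h)%:R)%:E) 1%g +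
    \sum_(j < m) iter j.+1 (jump_step mu q jump) home 1%g <= (3 / 4 : R)%:E)%E.
  have -> : 3 / 4 = 1 / 4 + 1 / 2 :> R by field.
  by rewrite EFinD; apply: leeD.
pose c1 := Num.bound (4 / eps).
have c1P : 4 / eps < c1%:R by rewrite archi_boundP// divr_ge0// ltW.
exists (4 + c1)%N => m.
(* Of 4 * m departures at most 3 * m are not fresh. *)
have [|hs shs] := @cheap_path R G X a rho mu q jump mu_prob q_gt0 q_lt1 (word_norm S)
  eps (3 / 4) (ltW eps0) theta_le (4 * m)%N (fun=> 0%N) (3 * m%:R + 1).
  rewrite big1 => [|j _]; last exact: iter_jump_step0.
  by rewrite adde0 lte_fin natrM; lra.
rewrite [X in _ + X < _]big1// addr0.
rewrite -mulr_sumr -natr_sum; set s := (\sum_(h <- hs) _)%N => hsP; exists hs.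
have s0 : 0 <= eps * s%:R by rewrite mulr_ge0// ltW.
have stale : (nb_stale a rho hs < 3 * m + 1)%N.
  rewrite -(ltr_nat R) natrD natrM; lra.
split.
  by move: stale (nb_fresh_stale a rho hs); rewrite shs; clear; lia.
rewrite shs mulnDl leq_add2l.
case: (posnP m) => [m0|m0].
  by move: shs; rewrite /s m0 muln0 => /size0nil ->; rewrite big_nil.
rewrite -(ler_nat R) natrM.
have : s%:R <= 4 / eps * m%:R.
  rewrite mulrAC ler_pdivlMr//.
  have st0 : 0 <= (nb_stale a rho hs)%:R :> R by [].
  have : 1 <= m%:R :> R by rewrite ler1n.
  lra.
move=> /le_trans; apply; rewrite ler_wpM2r//; exact: ltW.
Qed.

(** The [2 ^ m] ways of switching or not at [m] fresh departures of a path of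
length [O(m)] give distinct elements of norm [O(m)]. *)
Lemma wreath_exponential_growth : finitely_generated W -> exponential_growth R W.
Proof.
move=> fgW; apply: exponential_growth_crit => // T T_gen.
have [M MP] := word_norm_lipschitz S_gen T_gen (@walkerM A G X a).
have [c cP] := wreath_switch_choices.
exists ((word_norm T (lamp a rho b) + M) * c)%N => m.
have [hs [mhs hsc]] := cP m.
exists (switch_choices a rho b hs); split.
- exact: uniq_switch_choices.
- by rewrite size_switch_choices leq_pexp2l.
- move=> w /(switch_choices_norm T_gen.2 (M := fun h => (M * word_norm S h)%N)).
  move=> /(_ (fun h _ => MP h)) /leq_trans; apply.
  rewrite -big_distrr/= -mulnA.
  apply: leq_trans (leq_mul (leqnn _) hsc); by rewrite mulnDl !mulnDr (mulnC (size hs)) leq_add ?leq_addr ?leq_addl.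
Qed.

End FirstMomentAndGrowth.

Theorem theorem2 (R : realType) (G A : groupType) (X : Type)
    (a : right_action G X) (S : set G) (mu : G -> R) (D alpha C delta : R) :
  finite_generating_set S ->
  [set: X] !=set0 ->
  finitely_many_orbits a ->
  is_prob mu ->
  finite_set (supp mu) ->
  symmetric_measure mu ->
  non_degenerate mu ->
  alpha < 1 ->
  (forall n : nat, (0 < n)%N ->
     (drift S mu n <= (D * n%:R `^ alpha)%:E)%E) ->
  0 < delta ->
  alpha < delta ->
  (forall (rho : X) (n : nat), (0 < n)%N ->
     (\esum_(g in stab a rho) (conv_pow mu n g)%:E
        <= (C * n%:R `^ (- delta))%:E)%E) ->
  finitely_generated A ->
  (exists b : A, b != 1%g) ->
  (exists nu : wreath A a -> R,
     [/\ is_prob nu, symmetric_measure nu, finite_first_moment nu &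
         nontrivial_boundary nu]) /\
  exponential_growth R (wreath A a).
Proof.
move=> S_gen [rho _] orbits mu_prob _ mu_sym _ _ driftD delta0 alpha_delta returnC fgA [b b1].
have mu0 n : forall g, 0 <= conv_pow mu n g := conv_pow_ge0 mu_prob n.
have D_ge0 : 0 <= D.
  have := driftD 1%N isT; rewrite powR1 mulr1 -lee_fin; apply: le_trans.
  by apply: esum_ge0 => g _; rewrite lee_fin mulr_ge0.
have C_ge0 : 0 <= C.
  have := returnC rho 1%N isT; rewrite powR1 mulr1 -lee_fin; apply: le_trans.
  by apply: esum_ge0 => g _; rewrite lee_fin.
pose t : R := 2 `^ (- delta); pose r : R := 2 `^ alpha.
have t_gt0 : 0 < t by rewrite powR_gt0.
have r_gt0 : 0 < r by rewrite powR_gt0.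
have ln2 : 0 < ln 2 :> R by rewrite ln_gt0// ltr1n.
have pow2_lt1 (s : R) : s < 0 -> 2 `^ s < 1.
  move=> s0; rewrite /powR pnatr_eq0/= -[ltRHS]expR0 ltr_expR.
  by rewrite nmulr_rlt0.
have t_lt1 : t < 1 by apply: pow2_lt1; rewrite oppr_lt0.
have tr_lt1 : t * r < 1.
  rewrite /t /r -powRD; last by rewrite pnatr_eq0 implybT.
  by apply: pow2_lt1; lra.
(* Such a q exists because t < 1 and, as alpha < delta, t < 1 / r. *)
have [q [t_ltq q_lt1 qr_lt1]] : exists q, [/\ t < q, q < 1 & q * r < 1].
  exists ((t + Num.min 1 r^-1) / 2).
  have : t < Num.min 1 r^-1 by rewrite lt_min t_lt1 -div1r ltr_pdivlMr.
  have : Num.min 1 r^-1 <= 1 by rewrite ge_min lexx.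
  have : Num.min 1 r^-1 <= r^-1 by rewrite ge_min lexx orbT.
  set x := Num.min _ _ => xr x1 tx; split; [lra|lra|].
  by rewrite -ltr_pdivlMr// div1r; lra.
have q_gt0 : 0 < q by exact: lt_trans t_ltq.
have drift_le k : (drift S mu (2 ^ k) <= (D * r ^+ k)%:E)%E.
  by rewrite /r -powR_pow2; apply: driftD; rewrite expn_gt0.
have return_le k n : (2 ^ k <= n)%N ->
    (mean (conv_pow mu n) (at_home R a rho) <= (C * t ^+ k)%:E)%E.
  move=> kn; rewrite mean_at_home; apply: le_trans (returnC rho n _) _.
    by rewrite (leq_trans _ kn)// expn_gt0.
  by rewrite lee_fin ler_wpM2l// powR_decay// ltW.
have fgW : finitely_generated (wreath A a).
  by apply: finitely_generated_wreath => //; exists S.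
split; last first.
  exact: (wreath_exponential_growth S_gen mu_prob q_gt0 q_lt1 r_gt0 qr_lt1
    (ltW t_gt0) t_lt1 t_ltq C_ge0 D_ge0 drift_le b1 return_le).
exists (walk_switch mu rho b q); split.
- exact: walk_switch_prob.
- exact: walk_switch_symmetric.
- split=> // T T_gen.
  exact: (walk_switch_first_moment S_gen mu_prob q_gt0 q_lt1 r_gt0 qr_lt1 D_ge0 drift_le).
- have [T [fT gT]] := fgW.
  apply: walk_switch_boundary => //; first exact: countable_fg gT fT.
  exact: (green_jump0_lty mu_prob q_gt0 q_lt1 (ltW t_gt0) t_ltq C_ge0 return_le).
Qed.
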